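(* Let $H$ be Hall's universal locally finite group. For every subgroup $U \leq Aut(H)$ of index $[Aut(H) : U] < 2^{\aleph_0}$ there is a unique finite subgroup $A$ of $H$ such that $$\{ h \in Aut(H) : h(a) = a \text{ for all } a \in A \} \;\leq\; U \;\leq\; \{ h \in Aut(H) : h(A) = A \}.$$
   Context: Hall's universal locally finite group $H$ is the group, unique up to isomorphism, such that: (A) $H$ is countable; (B) $H$ is locally finite (every finitely generated subgroup is finite); (C) every finite group embeds into $H$; (D) any two isomorphic finite subgroups of $H$ are conjugate in $H$. $Aut(H)$ denotes the group of all automorphisms of $H$. The two groups bounding $U$ in the claim are called the pointwise and the setwise stabilizer of $A$, respectively. *)

(* Defs.v *)
From HB Require Import structures.
From mathcomp Require Import all_boot all_fingroup.
From mathcomp Require Import all_classical.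

Set Implicit Arguments.
Unset Strict Implicit.
Unset Printing Implicit Defensive.

Local Open Scope classical_set_scope.
Local Open Scope group_scope.

Definition is_subgroup (G : groupType) (A : set G) : Prop :=
  group_closed (mem A).

Definition generated_subgroup (G : groupType) (S : set G) : set G :=
  smallest (@is_subgroup G) S.

Definition isomorphic_subgroups (G : groupType) (A B : set G) : Prop :=
  exists f : G -> G,
    {in A &, {morph f : x y / x * y}} /\ set_bij A B f.

Definition conjugate_subgroups (G : groupType) (A B : set G) : Prop :=
  exists g : G, (fun x => x ^ g) @` A = B.

Record hall_universal (H : groupType) : Prop := HallUniversal {
  hall_countable : countable [set: H];
  hall_locally_finite : forall S : set H,
    finite_set S -> finite_set (generated_subgroup S);
  hall_embeds : forall gT : finGroupType,
    exists f : {multiplicative gT -> H}, injective f;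
  hall_conjugate : forall A B : set H,
    is_subgroup A -> finite_set A -> is_subgroup B -> finite_set B ->
    isomorphic_subgroups A B -> conjugate_subgroups A B
}.

Section AutomorphismGroup.
Variable H : groupType.

Definition is_aut (f : H -> H) : Prop :=
  {morph f : x y / x * y} /\ bijective f.

Record automorphism := Automorphism { aut_fun :> H -> H; _ : `[< is_aut aut_fun >] }.

HB.instance Definition _ := [isSub for aut_fun].
HB.instance Definition _ := [Choice of automorphism by <:].

Lemma autP (h : automorphism) : is_aut h.
Proof. by case: h => f /= /asboolP. Qed.

Lemma aut_ext (g h : automorphism) : g =1 h -> g = h.
Proof. by move=> gh; apply/val_inj/funext. Qed.

Fact aut_one_subproof : `[< is_aut (@idfun H) >].
Proof. by apply/asboolP; split=> //; exists id. Qed.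

Fact aut_mul_subproof (g h : automorphism) : `[< is_aut (g \o h) >].
Proof.
apply/asboolP; have [gM gB] := autP g; have [hM hB] := autP h.
by split; [move=> x y /=; rewrite hM gM | exact: bij_comp].
Qed.

Fact aut_inv_exists (h : automorphism) :
  exists g : automorphism, cancel g h /\ cancel h g.
Proof.
have [hM [k hK kK]] := autP h.
have kP : `[< is_aut k >].
  apply/asboolP; split; last by exists h.
  by move=> x y; apply: (can_inj hK); rewrite hM !kK.
by exists (Automorphism kP).
Qed.

Definition aut_one : automorphism := Automorphism aut_one_subproof.
(* Composition of functions: (g * h) x = g (h x). *)
Definition aut_mul (g h : automorphism) : automorphism :=
  Automorphism (aut_mul_subproof g h).
Definition aut_inv (h : automorphism) : automorphism :=
  projT1 (cid (aut_inv_exists h)).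

Lemma aut_invK (h : automorphism) : cancel (aut_inv h) h.
Proof. by rewrite /aut_inv; case: cid => g /= []. Qed.

Lemma autK (h : automorphism) : cancel h (aut_inv h).
Proof. by rewrite /aut_inv; case: cid => g /= []. Qed.

Fact aut_mulA : associative aut_mul.
Proof. by move=> f g h; apply: aut_ext. Qed.

Fact aut_1mul : left_id aut_one aut_mul.
Proof. by move=> h; apply: aut_ext. Qed.

Fact aut_mul1 : right_id aut_one aut_mul.
Proof. by move=> h; apply: aut_ext. Qed.

Fact aut_Vmul : left_inverse aut_one aut_inv aut_mul.
Proof. by move=> h; apply: aut_ext => x /=; rewrite autK. Qed.

Fact aut_mulV : right_inverse aut_one aut_inv aut_mul.
Proof. by move=> h; apply: aut_ext => x /=; rewrite aut_invK. Qed.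

HB.instance Definition _ := isGroup.Build automorphism
  aut_mulA aut_1mul aut_mul1 aut_Vmul aut_mulV.

Definition pointwise_stabilizer (A : set H) : set automorphism :=
  [set h : automorphism | forall a, A a -> h a = a].

Definition setwise_stabilizer (A : set H) : set automorphism :=
  [set h : automorphism | h @` A = A].

End AutomorphismGroup.

Definition left_cosets (G : groupType) (U : set G) : set (set G) :=
  range (fun g : G => (fun u => g * u) @` U).

Definition card_lt (T T' : Type) (A : set T) (B : set T') : Prop :=
  (A #<= B)%card /\ ~ (B #<= A)%card.

(* [set: nat -> bool] is a set of cardinality 2^aleph_0. *)
Definition index_lt_continuum (G : groupType) (U : set G) : Prop :=
  card_lt (left_cosets U) [set: nat -> bool].

(* Main.v *)
Require Import Defs.
From HB Require Import structures.
From mathcomp Require Import all_boot all_fingroup.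

(** A subgroup U of Aut(H) of index less than the continuum is shown to be open: it
contains the pointwise stabilizer of a finite subgroup. Among the finite subgroups with
this property, a minimal one A is then the required one.

Everything rests on homogeneity. Two embeddings of a finite group in H differ by a
conjugation ([hall_conj_embeddings]), so an embedding of a subgroup extends to any finite
group ([hall_extend]), and every automorphism of H agrees with a conjugation on each
finite subgroup. Hence finite configurations in H can be amalgamated, also together with
automorphisms acting on them ([hall_amalgamation]).

Openness follows from the existence of generic tuples of automorphisms of every length.
Tuples of automorphisms are [generic] if they realize all finite configurations; by a
back-and-forth argument two generic tuples that agree on a finite invariant subgroup are
conjugate over it ([generic_conjugate]), and to extend a generic tuple by one entry it is
enough to meet countably many open dense conditions ([generic_extension]). A subgroup of
small index meets the intersection of any such countable family near the identity
([small_index_generic]), and so does its complement unless the subgroup is open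
([outside_generic]). If U were not open, one could build a binary tree of automorphisms,
using at each level some u in U and v outside U that are generic over all previous
choices. Branches parting at that level conjugate u and v to the same automorphism, and
for this reason lie in different cosets of U. That makes continuum many cosets.

For the support, the key fact is that the centralizer in H of the intersection of two
finite subgroups A and B is generated by the centralizers of A and B
([hall_centralizers_generate]). Since automorphisms are locally inner, if U contains the
pointwise stabilizers of A and B, it contains that of their intersection
([stab_intersection]). Applied to a minimal A and its image under an element u of U, this
gives u(A) = A. Uniqueness holds because no element outside A has a finite orbit under the
centralizer of A ([hall_centralizer_moves]).

The centralizer fact is proved inside the symmetric group on several copies of a finite
group, where right multiplication by an element h centralizing the intersection is
expressed through commutators of permutations commuting with A and with B. *)

Set Implicit Arguments.
Unset Strict Implicit.
Unset Printing Implicit Defensive.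

Local Open Scope group_scope.

(** * Symmetric groups on copies of a finite group *)

(** One copy of the group for each index. Right multiplications act in the same way
on every sheet and give the regular embedding of the group in a symmetric group. *)
Definition sheets (gT : finGroupType) (I : finType) : finType := (gT * I)%type.

Section Fibrewise.
Variables (gT : finGroupType) (I : finType).
Notation W := (sheets gT I).

Fact right_act_inj (x : gT) : injective (fun w : W => (w.1 * x, w.2)).
Proof. by move=> [y i] [z j] [/mulIg-> ->]. Qed.
Definition right_perm x : {perm W} := perm (@right_act_inj x).

Fact left_perm_inj (l : I -> gT) : injective (fun w : W => (l w.2 * w.1, w.2)).
Proof. by move=> [y i] [z j] /= [+ ij]; rewrite ij => /mulgI->. Qed.
Definition left_perm l : {perm W} := perm (@left_perm_inj l).

Fact twist_perm_inj (e : I -> gT) : injective (fun w : W => (w.1 * e w.2, w.2)).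
Proof. by move=> [y i] [z j] /= [+ ij]; rewrite ij => /mulIg->. Qed.
Definition twist_perm e : {perm W} := perm (@twist_perm_inj e).

Fact fibre_perm_inj (f : gT -> {perm I}) : injective (fun w : W => (w.1, f w.1 w.2)).
Proof. by move=> [y i] [z j] /= [<-] /perm_inj->. Qed.
Definition fibre_perm f : {perm W} := perm (@fibre_perm_inj f).

(** These permute the sheets over each single group element, so that computing with
them reduces to computing in the symmetric group of the index type. *)
Definition local_perm (s : {perm I}) (X : {set gT}) : {perm W} :=
  fibre_perm (fun w => if w \in X then s else 1).

Lemma right_permE x w i : right_perm x (w, i) = (w * x, i).
Proof. by rewrite permE. Qed.

Lemma left_permE l w i : left_perm l (w, i) = (l i * w, i).
Proof. by rewrite permE. Qed.

Lemma twist_permE e w i : twist_perm e (w, i) = (w * e i, i).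
Proof. by rewrite permE. Qed.

Lemma fibre_permE f w i : fibre_perm f (w, i) = (w, f w i).
Proof. by rewrite permE. Qed.

Lemma right_permM : {morph right_perm : x y / x * y}.
Proof. by move=> x y; apply/permP=> -[w i]; rewrite permM !right_permE mulgA. Qed.

Lemma right_perm_inj (i : I) : injective right_perm.
Proof. by move=> x y /permP/(_ (1, i)); rewrite !right_permE !mul1g => -[]. Qed.

Lemma fibre_permM f g : fibre_perm f * fibre_perm g = fibre_perm (fun w => f w * g w).
Proof. by apply/permP=> -[w i]; rewrite permM !fibre_permE permM. Qed.

Lemma fibre_permV f : (fibre_perm f)^-1 = fibre_perm (fun w => (f w)^-1).
Proof.
apply: (mulgI (fibre_perm f)); rewrite mulgV fibre_permM.
by apply/permP=> -[w i]; rewrite fibre_permE mulgV !perm1.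
Qed.

Lemma eq_fibre_perm f g : f =1 g -> fibre_perm f = fibre_perm g.
Proof. by move=> fg; apply/permP=> w; rewrite !permE fg. Qed.

(** The commutator is trivial over every point where one of the factors is. *)
Lemma local_permR s t (X Y : {set gT}) :
  [~ local_perm s X, local_perm t Y] = local_perm [~ s, t] (X :&: Y).
Proof.
rewrite /commg /conjg !fibre_permV !fibre_permM; apply: eq_fibre_perm => w.
by rewrite inE; case: (w \in X); case: (w \in Y) => //=; rewrite ?invg1 ?mul1g ?mulg1 ?mulVg.
Qed.

Lemma local_permU s (X Y : {set gT}) : [disjoint X & Y] ->
  local_perm s (X :|: Y) = local_perm s X * local_perm s Y.
Proof.
move=> dXY; rewrite fibre_permM; apply: eq_fibre_perm => w.
rewrite inE; case: (boolP (w \in X)) => [wX|_]; last by rewrite mul1g.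
by rewrite (disjointFr dXY wX) mulg1.
Qed.

Lemma local_perm_cent s (X A : {set gT}) :
  (forall w a, a \in A -> (w * a \in X) = (w \in X)) ->
  local_perm s X \in 'C([set right_perm a | a in A]).
Proof.
move=> XA; apply/centP=> _ /imsetP[a aA ->]; apply/permP=> -[w i].
by rewrite !permM !(fibre_permE, right_permE) XA.
Qed.

Lemma left_perm_cent l (A : {set gT}) : left_perm l \in 'C([set right_perm a | a in A]).
Proof.
apply/centP=> _ /imsetP[a aA ->]; apply/permP=> -[w i].
by rewrite !permM !(left_permE, right_permE) mulgA.
Qed.

Section CentralizersGenerate.
Variables (A B : {group gT}) (Gamma : {group {perm W}}).
Hypotheses (cA : 'C([set right_perm a | a in A]) \subset Gamma).
Hypotheses (cB : 'C([set right_perm a | a in B]) \subset Gamma).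

(** A coset of A :&: B is the intersection of a coset of A with one of B, and sheet
permutations over these two commute with the respective subgroups. *)
Lemma local_comm_in s t x : local_perm [~ s, t] (x *: (A :&: B)) \in Gamma.
Proof.
have lcosetA (C : {group gT}) w a : a \in C -> (w * a \in x *: C) = (w \in x *: C).
  by move=> aC; rewrite !mem_lcoset mulgA groupMr.
have -> : x *: (A :&: B) = (x *: A) :&: (x *: B).
  by apply/setP=> w; rewrite !(inE, mem_lcoset).
rewrite -local_permR groupR //.
  by apply: (subsetP cA); apply: local_perm_cent => w a; apply: lcosetA.
by apply: (subsetP cB); apply: local_perm_cent => w a; apply: lcosetA.
Qed.

(** Over the coset of x, the right twist by e agrees with left multiplication by
the conjugates of e by x^-1, since e centralizes A :&: B. Left multiplications
commute with all right ones and therefore lie in Gamma, whereas the twist itself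
need not. *)
Lemma twisted_comm_in s t e x : (forall i, e i \in 'C(A :&: B)) ->
  local_perm [~ s, t] (x *: (A :&: B)) ^ twist_perm e \in Gamma.
Proof.
move=> eC; set F := local_perm _ _; set T := twist_perm e.
pose l i := e i ^ x^-1; set L := left_perm l.
have LV : L^-1 = left_perm (fun i => (l i)^-1).
  apply: (mulgI L); rewrite mulgV; apply/permP=> -[w i].
  by rewrite permM !left_permE mulKg perm1.
(* T L^-1 is the identity over the coset that carries F and preserves the rest, hence
   commutes with F. *)
pose q w i := (l i)^-1 * (w * e i).
have QE w i : (T * L^-1) (w, i) = (q w i, i).
  by rewrite LV permM twist_permE left_permE.
have fixX w i : w \in x *: (A :&: B) -> q w i = w.
  rewrite mem_lcoset => /(centP (eC i)) E.
  rewrite /q /l conjgE invgK !invgM invgK -!mulgA (mulgA _ w) -E.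
  by rewrite !mulgA mulgVK mulgV mul1g.
have inX w i : (q w i \in x *: (A :&: B)) = (w \in x *: (A :&: B)).
  apply/idP/idP => [qX|wX]; last by rewrite fixX.
  have /perm_inj[<-] // : (T * L^-1) (q w i, i) = (T * L^-1) (w, i).
  by rewrite !QE fixX.
have cTL : F ^ (T * L^-1) = F.
  apply/conjg_fixP/commgP/permP=> -[w i].
  rewrite [LHS]permM [RHS]permM QE /F !fibre_permE QE inX.
  by case: ifP => wX; rewrite ?perm1 // !fixX.
rewrite -[T](mulgVK L) conjgM cTL.
by rewrite groupJ ?local_comm_in //; apply: (subsetP cA); apply: left_perm_cent.
Qed.

(** Different left cosets carry disjoint local permutations, so the product of the
previous permutations over all cosets is the global twisted permutation. *)
Lemma twisted_global_in s t e : (forall i, e i \in 'C(A :&: B)) ->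
  local_perm [~ s, t] setT ^ twist_perm e \in Gamma.
Proof.
move=> eC; have: forall w c, c \in A :&: B -> (w * c \in [set: gT]) = (w \in [set: gT]).
  by move=> w c _; rewrite !in_setT.
have [n] := ubnP #|[set: gT]|; elim: n [set: gT] => // n IH X cardX XC.
have [->|/set0Pn[x xX]] := eqVneq X set0.
  have -> : local_perm [~ s, t] set0 = 1.
    by apply/permP=> -[w i]; rewrite fibre_permE inE !perm1.
  by rewrite conj1g.
have mem_coset w c : c \in A :&: B -> (w * c \in x *: (A :&: B)) = (w \in x *: (A :&: B)).
  by move=> cC; rewrite !mem_lcoset mulgA groupMr.
have sXC : x *: (A :&: B) \subset X.
  by apply/subsetP=> _ /lcosetP[c cC ->]; rewrite XC.
rewrite -(setID X (x *: (A :&: B))) (setIidPr sXC) local_permU; last first.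
  by rewrite -setI_eq0 setDE setICA setICr setI0.
rewrite conjMg groupM ?twisted_comm_in ?IH //.
  rewrite -ltnS (leq_trans _ cardX) // ltnS proper_card //.
  rewrite properEneq subsetDl andbT; apply/eqP=> /setP/(_ x).
  by rewrite !inE xX lcoset_refl.
by move=> w c cC; rewrite !inE XC // mem_coset.
Qed.

End CentralizersGenerate.
End Fibrewise.

(** Two families of sheets are needed because a cyclic shift of a single family may
be an odd permutation, hence not a commutator. *)
Definition cycle_sheets (gT : finGroupType) (h : gT) : finType :=
  ([subg <[h]>] * bool)%type.

(** The commutator r of s and t shifts the first family of sheets by h^-1 and the
second by h. The twist e is chosen such that passing from i to r i changes it by h;
dividing the permutation r of the sheets by its twisted form then leaves the right
multiplication by h. *)
Lemma right_perm_in_centralizers (gT : finGroupType) (A B : {group gT}) (h : gT)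
    (Gamma : {group {perm (sheets gT (cycle_sheets h))}}) :
  h \in 'C(A :&: B) ->
  'C([set right_perm _ a | a in A]) \subset Gamma ->
  'C([set right_perm _ a | a in B]) \subset Gamma ->
  right_perm _ h \in Gamma.
Proof.
move=> hC cA cB; set I := cycle_sheets h.
pose h1 : [subg <[h]>] := subg _ h.
have h1E : sgval h1 = h by rewrite subgK ?cycle_id.
have sfI : injective (fun i : I => if i.2 then i else (i.1 * h1, false) : I).
  by move=> [u [|]] [v [|]] //= /(congr1 fst)/= /mulIg->.
have tfI : injective (fun i : I => (i.1, ~~ i.2) : I).
  by move=> [u b] [v c] /= [-> /(can_inj negbK)->].
pose s := perm sfI; pose t := perm tfI; pose r := [~ s, t].
pose e (i : I) := if i.2 then (sgval i.1)^-1 else sgval i.1.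
have eC i : e i \in 'C(A :&: B).
  have uC : sgval i.1 \in 'C(A :&: B).
    by apply: (subsetP _ _ (subgP i.1)); rewrite cycle_subG.
  by rewrite /e; case: ifP; rewrite ?groupV.
have er i : e (r i) * h = e i.
  rewrite -(permKV (t * s) i); move: (_ i) => j; rewrite -permM -commgC.
  rewrite !permM; case: j => u [|]; rewrite !permE /e /= h1E //.
  have uh : sgval u * h = h * sgval u.
    exact: (centsP (cycle_abelian h) _ (subgP u) _ (cycle_id h)).
  by rewrite uh invgM mulgVK.
have EF : local_perm r setT ^ twist_perm e * right_perm I h = local_perm r setT.
  apply: (mulgI (twist_perm e)); rewrite [LHS]mulgA -conjgC.
  apply/permP=> -[w i]; rewrite -mulgA 3!permM.
  by rewrite !(fibre_permE, twist_permE, right_permE) !in_setT -mulgA er.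
have -> : right_perm I h = (local_perm r setT ^ twist_perm e)^-1 * local_perm r setT.
  by rewrite -{2}EF mulKg.
rewrite groupM ?groupV //; first exact: (twisted_global_in cA cB).
by apply: (subsetP cA); apply: local_perm_cent => w a _; rewrite !in_setT.
Qed.

(** Swapping the sheets over A alone commutes with right multiplication by A, but
takes right multiplication by an element outside A to a permutation that moves
points between the sheets. *)
Lemma swap_sheets (gT : finGroupType) (A : {group gT}) :
  exists2 t : {perm (sheets gT bool)},
    t \in 'C([set right_perm _ a | a in A]) &
    forall b c, b \notin A -> right_perm _ b ^ t <> right_perm _ c.
Proof.
have nI : injective negb by exact: can_inj negbK.
exists (local_perm (perm nI) A).
  by apply: local_perm_cent => w a aA; rewrite groupMr.
move=> b c bA E; have : (local_perm (perm nI) A * right_perm _ b ^ local_perm (perm nI) A)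
    (1, true) = (local_perm (perm nI) A * right_perm _ c) (1, true) by rewrite E.
rewrite -conjgC !permM !(right_permE, fibre_permE) mul1g group1 (negbTE bA) perm1.
by rewrite permE.
Qed.

From mathcomp Require Import all_classical.

Local Open Scope classical_set_scope.
Local Open Scope group_scope.

(** * Subgroups and embeddings *)

(** Only the values on A matter, so that maps can be extended and corrected without
changing their types. *)
Definition embedding (L M : groupType) (A : set L) (f : L -> M) : Prop :=
  (forall x y, A x -> A y -> f (x * y) = f x * f y) /\
  (forall x y, A x -> A y -> f x = f y -> x = y).

Section Subgroups.
Variable L : groupType.
Implicit Types A B S : set L.

Lemma subgroup1 A : is_subgroup A -> A 1.
Proof. by case=> /set_mem. Qed.

Lemma subgroupF A x y : is_subgroup A -> A x -> A y -> A (x * y^-1).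
Proof. by case=> _ Ad Ax Ay; apply/set_mem/Ad; apply/mem_set. Qed.

Lemma subgroupV A x : is_subgroup A -> A x -> A x^-1.
Proof. by move=> sA Ax; rewrite -[x^-1]mul1g; apply: subgroupF => //; apply: subgroup1. Qed.

Lemma subgroupM A x y : is_subgroup A -> A x -> A y -> A (x * y).
Proof.
by move=> sA Ax Ay; rewrite -[y]invgK; apply: subgroupF => //; apply: subgroupV.
Qed.

Lemma subgroupJ A x y : is_subgroup A -> A x -> A y -> A (x ^ y).
Proof.
by move=> sA Ax Ay; apply: subgroupM (subgroupM _ _ _) => //; apply: subgroupV.
Qed.

Lemma is_subgroupP A :
  A 1 -> (forall x y, A x -> A y -> A (x * y^-1)) -> is_subgroup A.
Proof.
move=> A1 Ad; split; first exact/mem_set.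
by move=> x y /set_mem Ax /set_mem Ay; apply/mem_set/Ad.
Qed.

Lemma generated_is_subgroup S : is_subgroup (generated_subgroup S).
Proof.
apply: is_subgroupP => [|x y gx gy] B [sB SB]; first exact: subgroup1.
by apply: subgroupF => //; [apply: gx | apply: gy].
Qed.

Lemma sub_generated S : S `<=` generated_subgroup S.
Proof. exact: sub_smallest. Qed.

Lemma subgroupI A B : is_subgroup A -> is_subgroup B -> is_subgroup (A `&` B).
Proof.
move=> sA sB; apply: is_subgroupP; first by split; apply: subgroup1.
by move=> x y [Ax Bx] [Ay By]; split; apply: subgroupF.
Qed.

End Subgroups.

Section Embeddings.
Variables L M : groupType.
Implicit Types (A : set L) (f : L -> M).

Lemma embedding1 A f : is_subgroup A -> embedding A f -> f 1 = 1.
Proof.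
move=> sA [fM _]; have A1 := subgroup1 sA.
by apply: (mulgI (f 1)); rewrite -fM // !mulg1.
Qed.

Lemma embeddingV A f x : is_subgroup A -> embedding A f -> A x -> f x^-1 = (f x)^-1.
Proof.
move=> sA ef Ax; have [fM _] := ef; apply: (mulgI (f x)).
by rewrite -fM // ?mulgV ?(embedding1 sA ef) //; apply: subgroupV.
Qed.

Lemma embeddingJ A f x y :
  is_subgroup A -> embedding A f -> A x -> A y -> f (x ^ y) = f x ^ f y.
Proof.
move=> sA ef Ax Ay; have [fM _] := ef.
rewrite !conjgE fM ?fM ?(embeddingV sA ef) //; last exact: subgroupM.
exact: subgroupV.
Qed.

Lemma image_is_subgroup A f : is_subgroup A -> embedding A f -> is_subgroup (f @` A).
Proof.
move=> sA ef; apply: is_subgroupP.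
  by exists 1; [apply: subgroup1 | apply: embedding1 ef].
move=> _ _ [x Ax <-] [y Ay <-]; exists (x * y^-1); first exact: subgroupF.
have [fM _] := ef.
by rewrite fM ?(embeddingV sA ef) //; apply: subgroupV.
Qed.

Lemma embedding_conj A f r : embedding A f -> embedding A (fun x => f x ^ r).
Proof.
case=> fM fI; split=> x y Ax Ay; first by rewrite fM // conjMg.
by move/conjg_inj; apply: fI.
Qed.

End Embeddings.

Section SubgroupType.
Variables (L : groupType) (s : seq L).

(** The closure proof is a parameter so that the group structure can be attached to
the type. *)
Definition subgroup_type of group_closed (mem s : {pred L}) : Type := seq_sub s.

Variable cs : group_closed (mem s : {pred L}).

HB.instance Definition _ := Finite.on (subgroup_type cs).
HB.instance Definition _ := [isSub of subgroup_type cs for @ssval _ s].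
HB.instance Definition _ :=
  SubChoice_isSubGroup.Build L (mem s) (subgroup_type cs) cs.
End SubgroupType.

Lemma finite_subgroup_type (L : groupType) (A : set L) :
  is_subgroup A -> finite_set A ->
  exists (gT : finGroupType) (f : gT -> L),
    [/\ {morph f : x y / x * y}, injective f & range f = A].
Proof.
move=> sA /finite_seqP[s As].
have cs : group_closed (mem s : {pred L}).
  have in_s x : (x \in mem s) = (x \in A).
    by rewrite As; apply/idP/idP => [xs|/set_mem//]; apply/mem_set.
  by have [A1 Ad] := sA; split=> [|x y]; rewrite !in_s //; apply: Ad.
exists (subgroup_type cs : finGroupType), (fun x => ssval (x : subgroup_type cs)).
split; first exact: (@valM _ _ (subgroup_type cs)).
  exact: (@val_inj _ _ (seq_sub s)).
rewrite As; apply/seteqP; split=> [_ [x _ <-]|x xs]; first exact: (valP x).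
by exists (SeqSub xs).
Qed.

(** * Homogeneity *)

Lemma range_is_subgroup (gT : finGroupType) (L : groupType) (f : gT -> L) :
  {morph f : x y / x * y} -> is_subgroup (range f).
Proof.
move=> fM; have f1 : f 1 = 1 by apply: (mulgI (f 1)); rewrite -fM !mulg1.
apply: is_subgroupP => [|_ _ [x _ <-] [y _ <-]]; first by exists 1.
exists (x * y^-1) => //; rewrite fM; congr (_ * _).
by apply: (mulgI (f y)); rewrite -fM !mulgV.
Qed.

Lemma range_finite (T : finType) (U : Type) (f : T -> U) : finite_set (range f).
Proof. exact/finite_image/finite_finset. Qed.

Lemma range_isomorphic (gT : finGroupType) (L : groupType) (f g : gT -> L) :
  {morph f : x y / x * y} -> injective f ->
  {morph g : x y / x * y} -> injective g ->
  isomorphic_subgroups (range f) (range g).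
Proof.
move=> fM fI gM gI.
have [k fk] : exists k : L -> gT, cancel f k.
  exists (fun y => if pselect (exists x, f x = y) is left P then projT1 (cid P) else 1).
  move=> x; case: pselect => [P|[]]; last by exists x.
  by case: cid => z /= /fI.
exists (g \o k); split.
  move=> y z /set_mem[a _ <-] /set_mem[b _ <-] /=.
  by rewrite -fM !fk gM.
split.
- by move=> _ [a _ <-]; exists a; rewrite //= fk.
- by move=> y z /set_mem[a _ <-] /set_mem[b _ <-] /=; rewrite !fk => /gI->.
- by move=> _ [a _ <-]; exists (f a); [exists a | rewrite /= fk].
Qed.

Definition right_regular (gT : finGroupType) (x : gT) : {perm gT} := perm (mulIg x).

Lemma right_regularM (gT : finGroupType) :
  {morph @right_regular gT : x y / x * y}.
Proof. by move=> x y; apply/permP=> z; rewrite permM !permE /= mulgA. Qed.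

Lemma right_regular_inj (gT : finGroupType) : injective (@right_regular gT).
Proof. by move=> x y /permP/(_ 1); rewrite !permE !mul1g. Qed.

Section Hall.
Variables (H : groupType) (hallH : hall_universal H).
Implicit Types A B G P S Z : set H.

(** The conjugacy property of H only conjugates the images of two embeddings of a
finite group onto each other, and so induces an unknown automorphism of that group.
Inside the symmetric group on the group, itself embedded in H, every automorphism of the
regular representation is a conjugation, and this corrects the discrepancy. *)
Lemma hall_conj_embeddings (gT : finGroupType) (f g : gT -> H) :
  {morph f : x y / x * y} -> injective f ->
  {morph g : x y / x * y} -> injective g ->
  exists r, forall x, g x = f x ^ r.
Proof.
have [e eI] := hall_embeds hallH {perm gT}.
pose r0 x := e (right_regular x).
have r0M : {morph r0 : x y / x * y} by move=> x y; rewrite /r0 right_regularM gmulfM.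
have r0I : injective r0 by move=> x y /eI/right_regular_inj.
suff to_r0 (k : gT -> H) : {morph k : x y / x * y} -> injective k ->
    exists r, forall x, r0 x = k x ^ r.
  move=> fM fI gM gI; have [r fr] := to_r0 f fM fI; have [s gs] := to_r0 g gM gI.
  by exists (r * s^-1) => x; rewrite conjgM -fr gs conjgK.
move=> kM kI.
have [d kd] : conjugate_subgroups (range k) (range r0).
  apply: (hall_conjugate hallH); do ?exact: range_is_subgroup; do ?exact: range_finite.
  exact: range_isomorphic.
have /choice[s ks] : forall x, exists y, k x ^ d = r0 y.
  move=> x; have : range r0 (k x ^ d) by rewrite -kd; exists (k x) => //; exists x.
  by case=> y _ <-; exists y.
have sI : injective s by move=> x y sxy; apply/kI/(@conjg_inj _ d); rewrite !ks sxy.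
have sM x y : s (x * y) = s x * s y.
  by apply: r0I; rewrite r0M -!ks kM conjMg.
exists (d * (e (perm sI))^-1) => x.
have eE : embedding [set: {perm gT}] e by split=> y z _ _; [exact: gmulfM | apply: eI].
have sT : is_subgroup [set: {perm gT}] by apply: is_subgroupP.
rewrite conjgM ks; apply/(@conjg_inj _ (e (perm sI))); rewrite conjgKV.
rewrite -(embeddingJ sT eE) //; congr (e _).
apply/permP=> y; rewrite conjgE !permM 2!permE sM -(permE sI ((perm sI)^-1%g y)).
by rewrite permKV permE.
Qed.

Lemma hall_conj A (f g : H -> H) : is_subgroup A -> finite_set A ->
  embedding A f -> embedding A g -> exists r, forall x, A x -> g x = f x ^ r.
Proof.
move=> sA fA [fM fI] [gM gI].
have [gT [k [kM kI kA]]] := finite_subgroup_type sA fA.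
have Ak x : A (k x) by rewrite -kA; exists x.
have [||||r rP] := @hall_conj_embeddings gT (f \o k) (g \o k).
- by move=> x y; rewrite /= kM fM.
- by move=> x y /fI-/(_ (Ak x) (Ak y))/kI.
- by move=> x y; rewrite /= kM gM.
- by move=> x y /gI-/(_ (Ak x) (Ak y))/kI.
by exists r => x; rewrite -{1}kA => -[y _ <-]; apply: rP.
Qed.

Lemma hall_embedding (L : groupType) (K : set L) :
  is_subgroup K -> finite_set K -> exists e : L -> H, embedding K e.
Proof.
move=> sK fK; have [gT [k [kM kI kK]]] := finite_subgroup_type sK fK.
have [e eI] := hall_embeds hallH gT.
have [l kl] : exists l : L -> gT, cancel k l.
  exists (fun y => if pselect (exists x, k x = y) is left P then projT1 (cid P) else 1).
  move=> x; case: pselect => [P|[]]; last by exists x.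
  by case: cid => z /= /kI.
exists (e \o l); rewrite -kK; split=> _ _ [x _ <-] [y _ <-].
  by rewrite /= -kM !kl gmulfM.
by rewrite /= !kl => /eI->.
Qed.

(** Since embeddings of a finite group are unique up to conjugation, any embedding
of the larger group can be conjugated so as to extend a prescribed one. *)
Lemma hall_extend (L : groupType) (K K0 : set L) (j : L -> H) :
  is_subgroup K -> finite_set K -> is_subgroup K0 -> K0 `<=` K ->
  embedding K0 j ->
  exists e : L -> H, embedding K e /\ forall x, K0 x -> e x = j x.
Proof.
move=> sK fK sK0 K0K ej; have [e ee] := hall_embedding sK fK.
have [gT [k [kM kI kK]]] := finite_subgroup_type sK0 (sub_finite_set K0K fK).
have Kk x : K0 (k x) by rewrite -kK; exists x.
have [||||r rP] := @hall_conj_embeddings gT (e \o k) (j \o k).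
- by move=> x y; rewrite /= kM (proj1 ee) //; apply: K0K.
- by move=> x y /(proj2 ee _ _ (K0K _ (Kk x)) (K0K _ (Kk y)))/kI.
- by move=> x y; rewrite /= kM (proj1 ej).
- by move=> x y /(proj2 ej _ _ (Kk x) (Kk y))/kI.
exists (fun x => e x ^ r); split; first exact: embedding_conj.
by move=> x; rewrite -{1}kK => -[y _ <-]; apply/esym/rP.
Qed.

End Hall.

(** * Amalgamation with conjugations *)

Lemma finite_inj_onto (T : choiceType) (A : set T) (f : T -> T) :
  finite_set A -> (forall x, A x -> A (f x)) ->
  (forall x y, A x -> A y -> f x = f y -> x = y) ->
  forall y, A y -> exists2 x, A x & f x = y.
Proof.
move=> /finite_seqP[s ->] fA fI y.
rewrite /= -mem_undup => ys; set u := undup s in ys.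
have uE x : (x \in u) = (x \in s) by rewrite mem_undup.
have fu : uniq (map f u).
  rewrite map_inj_in_uniq ?undup_uniq // => x z.
  by rewrite !uE; apply: fI.
have sub : {subset map f u <= u}.
  by move=> _ /mapP[x xu ->]; rewrite uE; apply: fA; rewrite /= -uE.
have [|_ E] := uniq_min_size fu sub; first by rewrite size_map.
by move: ys; rewrite -E => /mapP[x xu ->]; exists x; rewrite //= -uE.
Qed.

Section Amalgamation.
Variables (H : groupType) (hallH : hall_universal H).
Variables (P S G0 : set H).
Hypotheses (sP : is_subgroup P) (fP : finite_set P).
Hypotheses (sS : is_subgroup S) (fS : finite_set S).
Hypotheses (s0 : is_subgroup G0) (G0P : G0 `<=` P) (G0S : G0 `<=` S).

Let compatible (r : H * H) := forall g, G0 g -> g ^ r.1 = g ^ r.2 /\ G0 (g ^ r.1).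

Let compatible_subgroup : is_subgroup compatible.
Proof.
apply: is_subgroupP => [g g0|r1 r2 c1 c2 g g0]; first by rewrite !conjg1.
have [k k0 kg] : exists2 k, G0 k & k ^ r2.1 = g ^ r1.1.
  have [g1E g10] := c1 g g0.
  apply: (finite_inj_onto (f := fun k => k ^ r2.1) (sub_finite_set G0P fP)) g10.
    by move=> x /c2[].
  by move=> x y _ _ /conjg_inj.
have [k2E _] := c2 k k0; have [gE _] := c1 g g0.
have e1 : g ^ (r1.1 * r2.1^-1) = k by rewrite conjgM -kg conjgK.
have e2 : g ^ (r1.2 * r2.2^-1) = k by rewrite conjgM -gE -kg k2E conjgK.
by rewrite -[(_ * _).1]/(r1.1 * r2.1^-1) -[(_ * _).2]/(r1.2 * r2.2^-1) e1 e2.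
Qed.

Let conj_pair (L M : groupType) (a c : L) (b d : M) : (a, b) ^ (c, d) = (a ^ c, b ^ d).
Proof. by []. Qed.

Let K1 : set (H * H * H) := [set x | [/\ P x.1.1, P x.1.2 & S x.2]].
Let K2 : set (H * H * H) := [set x | [/\ S x.1.1, P x.1.2 & S x.2]].
Let D1 : set (H * H * H) := [set x | P x.1.1 /\ (x.1.2, x.2) = 1].
(* The subgroup generated by G0 and the triples (q, p, q) with (p, q) compatible. *)
Let D2 : set (H * H * H) :=
  [set x | [/\ P x.1.2, S x.2, compatible (x.1.2, x.2) & G0 (x.2^-1 * x.1.1)]].

Let sK1 : is_subgroup K1.
Proof.
apply: is_subgroupP; first by split; apply: subgroup1.
by move=> x y [? ? ?] [? ? ?]; split; apply: subgroupF.
Qed.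

Let sK2 : is_subgroup K2.
Proof.
apply: is_subgroupP; first by split; apply: subgroup1.
by move=> x y [? ? ?] [? ? ?]; split; apply: subgroupF.
Qed.

Let sD1 : is_subgroup D1.
Proof.
apply: is_subgroupP; first by split=> //; apply: subgroup1.
move=> [[x x'] x''] [[y y'] y''] [Px /= [-> ->]] [Py /= [-> ->]]; split; first exact: subgroupF.
by rewrite /= !mulgV.
Qed.

Let sD2 : is_subgroup D2.
Proof.
apply: is_subgroupP.
  split; rewrite /= ?invg1 ?mulg1; do ?exact: subgroup1.
  exact: (subgroup1 compatible_subgroup).
move=> [[x p] q] [[x' p'] q'] [/= Pp Sq cpq g0] [/= Pp' Sq' cpq' g0'].
have cV := subgroupV compatible_subgroup cpq'.
split; rewrite /=; do ?exact: subgroupF.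
  exact: (subgroupF compatible_subgroup cpq cpq').
have -> : (q * q'^-1)^-1 * (x * x'^-1) = ((q^-1 * x) * (q'^-1 * x')^-1) ^ q'^-1.
  by rewrite conjgE !invgM !invgK !mulgA mulgK.
by have [e e'] := cV _ (subgroupF s0 g0 g0'); move: e'; rewrite e.
Qed.

Let fK (A B C : set H) : finite_set A -> finite_set B -> finite_set C ->
  finite_set [set x : H * H * H | [/\ A x.1.1, B x.1.2 & C x.2]].
Proof.
move=> fA fB fC; apply: sub_finite_set (finite_setX (finite_setX fA fB) fC).
by move=> [[a b] c] [].
Qed.

(** Embed P and S as the first factors of P * P * S and S * P * S, amalgamated over G0,
and let E p q be the common image of (p, p, q) and (q, p, q). The last two coordinates make the
assignment from the first group to the second well defined, because they determine
p and q in every relation; homogeneity of H then glues the two groups. *)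
Lemma hall_amalgamation : exists (t : H) (E : H -> H -> H),
  (forall g, G0 g -> g ^ t = g) /\
  forall p q, P p -> S q -> (forall g, G0 g -> g ^ p = g ^ q /\ G0 (g ^ p)) ->
    (forall g, P g -> g ^ E p q = g ^ p) /\
    (forall z, S z -> (z ^ t) ^ E p q = (z ^ q) ^ t).
Proof.
have ej1 : embedding D1 (fun x => x.1.1).
  by split=> // -[[x x'] x''] [[y y'] y''] [_ /= [-> ->]] [_ /= [-> ->]] /= ->.
have D1K1 : D1 `<=` K1.
  by move=> [[x x'] x''] [Px /= [-> ->]]; split=> //; apply: subgroup1.
have [e1 [ee1 e1E]] := hall_extend hallH sK1 (fK fP fP fS) sD1 D1K1 ej1.
pose j2 (x : H * H * H) := e1 (x.1.2 * x.2^-1 * x.1.1, x.1.2, x.2).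
have D2K1 x : D2 x -> K1 (x.1.2 * x.2^-1 * x.1.1, x.1.2, x.2).
  move=> [Pp Sq cpq g0]; split=> //=; rewrite -mulgA.
  by apply: subgroupM => //; apply: G0P.
have ej2 : embedding D2 j2.
  split=> [x y Dx Dy|x y Dx Dy].
    rewrite /j2 -(proj1 ee1); [|exact: D2K1|exact: D2K1].
    congr e1; congr (_, _, _) => /=.
    have [_ _ _ g0] := Dx; have [_ _ cy _] := Dy.
    have /= [+ _] := cy _ g0.
    rewrite !conjgE => cyE; rewrite !invgM !mulgA.
    set p := x.1.2; set q := x.2; set p' := y.1.2; set q' := y.2.
    have -> : p * q^-1 * x.1.1 * p' = p * (p' * (p'^-1 * (q^-1 * x.1.1 * p'))).
      by rewrite mulVKg !mulgA.
    by rewrite cyE !mulgA mulgK.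
  move=> /(proj2 ee1 _ _ (D2K1 _ Dx) (D2K1 _ Dy)).
  case: x y {Dx Dy} => [[x p] q] [[y p'] q'] /= [E Ep Eq].
  by move: E; rewrite Ep Eq => /mulgI ->.
have D2K2 : D2 `<=` K2.
  move=> [[x p] q] [/= Pp Sq _ g0]; split=> //=.
  by rewrite -(mulVKg q x); apply: subgroupM => //; apply: G0S.
(* The second embedding agrees with the first on G0 and on the compatible pairs. *)
have [e2 [ee2 e2E]] := hall_extend hallH sK2 (fK fS fP fS) sD2 D2K2 ej2.
have K2S z : S z -> K2 (z, 1, 1) by split=> //; apply: subgroup1.
have K1P z : P z -> K1 (z, 1, 1) by split=> //; apply: subgroup1.
have e1P z : P z -> e1 (z, 1, 1) = z by move=> Pz; rewrite e1E.
have [t tP] : exists t, forall z, S z -> e2 (z, 1, 1) = z ^ t.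
  apply: (hall_conj hallH (f := id)) => //; split=> x y Sx Sy.
    rewrite -(proj1 ee2); [|exact: K2S|exact: K2S].
    by rewrite -[(x, 1, 1) * _]/(x * y, 1 * 1, 1 * 1) !mulg1.
  by move=> /(proj2 ee2 _ _ (K2S _ Sx) (K2S _ Sy))[].
exists t, (fun p q => e1 (p, p, q)); split.
  move=> g g0; rewrite -tP; last exact: G0S.
  rewrite e2E; last first.
    split; rewrite /= ?invg1 ?mul1g //; do ?exact: subgroup1.
    exact: (subgroup1 compatible_subgroup).
  by rewrite /j2 /= invg1 !mul1g; apply/e1P/G0P.
move=> p q Pp Sq cpq; split=> [g Pg|z Sz].
  have Kpq : K1 (p, p, q) by [].
  rewrite -[X in X ^ _ = _]e1P // -(embeddingJ sK1 ee1 (K1P _ Pg) Kpq).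
  by rewrite !conj_pair !conj1g; apply: e1P; apply: (subgroupJ sP).
have -> : e1 (p, p, q) = e2 (q, p, q).
  rewrite e2E; first by rewrite /j2 /= mulgVK.
  by split=> //=; rewrite mulVg; apply: subgroup1.
rewrite -!tP //; last exact: subgroupJ.
have Kpq : K2 (q, p, q) by [].
rewrite -(embeddingJ sK2 ee2 (K2S _ Sz) Kpq).
by rewrite !conj_pair !conj1g.
Qed.

End Amalgamation.

(** * Centralizers in Hall's group *)

Section HallCentralizers.
Variables (H : groupType) (hallH : hall_universal H).
Implicit Types A B D : set H.

Lemma hall_extend_finite (gT rT : finGroupType) (r : gT -> rT) (k : gT -> H) :
  {morph r : x y / x * y} -> injective r ->
  {morph k : x y / x * y} -> injective k ->
  exists e : rT -> H, embedding setT e /\ forall x, e (r x) = k x.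
Proof.
move=> rM rI kM kI; have [e eI] := hall_embeds hallH rT.
have [||||d dP] := hall_conj_embeddings hallH (f := e \o r) (g := k) => //.
- by move=> x y; rewrite /= rM gmulfM.
- by move=> x y /eI/rI.
exists (fun z => e z ^ d); split=> [|x]; last by rewrite dP.
by apply: embedding_conj; split=> x y _ _; [exact: gmulfM | exact: eI].
Qed.

Lemma preimage_group (gT : finGroupType) (k : gT -> H) A :
  {morph k : x y / x * y} -> is_subgroup A ->
  exists A0 : {group gT}, forall x, (x \in A0) = `[< A (k x) >].
Proof.
move=> kM sA.
have gA : group_set [set x | `[< A (k x) >]]%SET.
  apply/group_setP; split=> [|x y]; rewrite !inE.
    have k1 : k 1 = 1 by apply: (mulgI (k 1)); rewrite -kM !mulg1.
    by rewrite k1; exact: (subgroup1 sA).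
  by move=> Ax Ay; rewrite kM; apply: (subgroupM sA).
by exists (group gA) => x; rewrite inE.
Qed.

(** The finite group generated by A, B and h is embedded in a symmetric group in which
h becomes a product of elements centralizing A or B, and this symmetric group is
embedded in H over it. *)
Lemma hall_centralizers_generate A B D :
  is_subgroup A -> finite_set A -> is_subgroup B -> finite_set B ->
  is_subgroup D ->
  (forall x, (forall a, A a -> a ^ x = a) -> D x) ->
  (forall x, (forall b, B b -> b ^ x = b) -> D x) ->
  forall h, (forall c, A c -> B c -> c ^ h = c) -> D h.
Proof.
move=> sA fA sB fB sD cA cB h hC.
pose F := generated_subgroup (A `|` B `|` [set h]).
have fF : finite_set F.
  by apply: (hall_locally_finite hallH); rewrite !finite_setU.
have AF x : A x -> F x by move=> Ax; apply: sub_generated; left; left.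
have BF x : B x -> F x by move=> Bx; apply: sub_generated; left; right.
have [gT [k [kM kI kF]]] := finite_subgroup_type (generated_is_subgroup _) fF.
have [h0 kh] : exists h0, k h0 = h.
  have : F h by apply: sub_generated; right.
  by rewrite /F -kF => -[h0 _ <-]; exists h0.
have kJ x y : k (x ^ y) = k x ^ k y.
  have kE : embedding [set: gT] k by split=> u v _ _; [exact: kM | exact: kI].
  by apply: (embeddingJ _ kE) => //; exact: is_subgroupP.
have [A0 A0P] := preimage_group kM sA; have [B0 B0P] := preimage_group kM sB.
pose rT : finGroupType := {perm (sheets gT (cycle_sheets h0))}.
pose r : gT -> rT := @right_perm gT (cycle_sheets h0).
have rI : injective r by exact: (@right_perm_inj gT (cycle_sheets h0) (1, true)).
have [e [eE er]] := hall_extend_finite (@right_permM gT _) rI kM kI.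
have eM : {morph e : x y / x * y} by move=> x y; apply: (proj1 eE).
have [G0 G0P] := preimage_group eM sD.
have cent C (C0 : {group gT}) : (forall x, C x -> F x) ->
    (forall x, (x \in C0) = `[< C (k x) >]) ->
    (forall x, (forall a, C a -> a ^ x = a) -> D x) ->
    ('C([set r a | a in C0]) \subset G0)%SET.
  move=> CF C0P cC; apply/fintype.subsetP=> z zC; rewrite G0P; apply/asboolP/cC=> a Ca.
  have [x kx] : exists x, k x = a by move: (CF _ Ca); rewrite /F -kF => -[x _ <-]; exists x.
  rewrite -kx -er -(embeddingJ _ eE) //; last exact: is_subgroupP.
  congr e; apply/conjg_fixP/commgP/commute_sym/(centP zC)/imsetP.
  by exists x => //; rewrite C0P kx; apply/asboolP.
have : r h0 \in G0.
  apply: (right_perm_in_centralizers _ (cent A A0 AF A0P cA) (cent B B0 BF B0P cB)).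
  apply/centP=> x; rewrite inE A0P B0P => /andP[/asboolP Ax /asboolP Bx].
  by apply/commute_sym/commgP/conjg_fixP/kI; rewrite kJ kh hC.
by rewrite G0P er kh => /asboolP.
Qed.

(** The right multiplications by the group generated by A, B and b preserve the
sheets, but the conjugate of b by the swap over A does not, and so it is not in B. *)
Lemma hall_centralizer_moves A B b :
  is_subgroup A -> finite_set A -> finite_set B -> ~ A b ->
  exists2 t, forall a, A a -> a ^ t = a & ~ B (b ^ t).
Proof.
move=> sA fA fB Ab.
pose F := generated_subgroup (A `|` B `|` [set b]).
have fF : finite_set F.
  by apply: (hall_locally_finite hallH); rewrite !finite_setU.
have [gT [k [kM kI kF]]] := finite_subgroup_type (generated_is_subgroup _) fF.
have inF x : F x -> exists y, k y = x by rewrite /F -kF => -[y _ <-]; exists y.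
have [b0 kb] : exists b0, k b0 = b by apply: inF; apply: sub_generated; right.
have [A0 A0P] := preimage_group kM sA.
have [t tA tb] := swap_sheets A0.
have rI : injective (@right_perm gT bool) by exact: (@right_perm_inj gT bool true).
have [e [eE er]] := hall_extend_finite (@right_permM gT _) rI kM kI.
have sT : is_subgroup [set: {perm (sheets gT bool)}] by exact: is_subgroupP.
exists (e t) => [a Aa|Bb].
  have [x kx] : exists x, k x = a by apply: inF; apply: sub_generated; left; left.
  rewrite -kx -er -(embeddingJ sT eE) //.
  congr e; apply/conjg_fixP/commgP/commute_sym/(centP tA)/imsetP.
  by exists x => //; rewrite A0P kx; apply/asboolP.
have [c kc] : exists c, k c = b ^ e t by apply: inF; apply: sub_generated; left; right.
have bA0 : b0 \notin A0 by rewrite A0P kb; apply/asboolP.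
apply: (tb b0 c bA0); apply: (proj2 eE) => //.
by rewrite (embeddingJ sT eE) // !er kb kc.
Qed.

End HallCentralizers.

(** * Limits and trees of automorphisms *)

Section Topology.
Variable H : groupType.
Notation Aut := (automorphism H).
Implicit Types (f g h : Aut) (D K : set H).

Lemma autM h x y : h (x * y) = h x * h y.
Proof. by have [->] := autP h. Qed.

Lemma aut_inj h : injective h.
Proof. exact: can_inj (autK h). Qed.

Lemma aut_mulE g h x : (g * h) x = g (h x).
Proof. by []. Qed.

Lemma aut_mulKE g x : g (g^-1 x) = x.
Proof. exact: aut_invK. Qed.

Lemma aut_mulVKE g x : g^-1 (g x) = x.
Proof. exact: autK. Qed.

Definition agree D g h := forall x, D x -> g x = h x.

Lemma stabV D g : pointwise_stabilizer D g -> pointwise_stabilizer D g^-1.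
Proof. by move=> sg x Dx; rewrite -{1}(sg x Dx) aut_mulVKE. Qed.

Lemma stabM D g h : pointwise_stabilizer D g -> pointwise_stabilizer D h ->
  pointwise_stabilizer D (g * h).
Proof. by move=> sg sh x Dx; rewrite aut_mulE sh // sg. Qed.

Lemma stab_sub D K : D `<=` K -> pointwise_stabilizer K `<=` pointwise_stabilizer D.
Proof. by move=> DK g sg x /DK; apply: sg. Qed.

Lemma agree_stab D g h : agree D g h -> pointwise_stabilizer D (g^-1 * h).
Proof. by move=> gh x Dx; rewrite aut_mulE -gh // aut_mulVKE. Qed.

(** Agreement of consecutive terms on D n gives a pointwise limit; the preimages in
the last hypothesis make the limit surjective. *)
Lemma aut_limit (g : nat -> Aut) (D : nat -> set H) :
  (forall n, D n `<=` D n.+1) -> (forall n, agree (D n) (g n.+1) (g n)) ->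
  (forall x, exists n, D n x) -> (forall y, exists n x, D n x /\ g n x = y) ->
  exists f : Aut, forall n, agree (D n) f (g n).
Proof.
move=> Dinc gD cover onto.
have Dle m n : (m <= n)%N -> D m `<=` D n.
  move=> /subnK<-; elim: (n - m)%N => // k IH x Dx.
  by rewrite addSn; apply/Dinc/IH.
have gle m n : (m <= n)%N -> agree (D m) (g n) (g m).
  move=> /subnK<- x Dx; elim: (n - m)%N => // k <-.
  by rewrite addSn gD //; apply: Dle Dx; apply: leq_addl.
have /choice[N NP] := cover.
pose f x := g (N x) x.
have fE n x : D n x -> f x = g n x.
  move=> Dx; rewrite /f; have [le|/ltnW le] := leqP (N x) n; last exact: gle.
  by rewrite -(gle _ _ le x (NP x)).
have fM : {morph f : x y / x * y}.
  move=> x y; pose n := maxn (N (x * y)) (maxn (N x) (N y)).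
  have inD z m : (N z <= m)%N -> D m z by move=> le; apply: Dle le _ (NP z).
  rewrite !(fE n) ?autM //; apply: inD; rewrite /n !leq_max leqnn ?orbT //.
have fI : injective f.
  move=> x y; pose n := maxn (N x) (N y).
  have inD z m : (N z <= m)%N -> D m z by move=> le; apply: Dle le _ (NP z).
  rewrite !(fE n); first exact: aut_inj.
    by apply: inD; rewrite leq_maxr.
  by apply: inD; rewrite leq_maxl.
have /choice[k kf] : forall y, exists x, f x = y.
  by move=> y; have [n [x [Dx <-]]] := onto y; exists x; apply: fE.
have autf : `[< is_aut f >].
  by apply/asboolP; split=> //; exists k => // x; apply: fI; rewrite kf.
by exists (Automorphism autf) => n x; apply: fE.
Qed.

Lemma countable_onto : countable [set: H] -> exists e : nat -> H, forall x, exists n, e n = x.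
Proof.
move=> /countable_injP[f fI].
exists (fun n => if pselect (exists x, f x = n) is left P then projT1 (cid P) else 1) => x.
exists (f x); case: pselect => [P|[]]; last by exists x.
by case: cid => y /= /fI; apply; rewrite in_setT.
Qed.

(** Otherwise the cosets of the F a would be continuum many. *)
Lemma index_collision (U : set Aut) (F : (nat -> bool) -> Aut) :
  is_subgroup U -> index_lt_continuum U ->
  exists a b, a <> b /\ U ((F a)^-1 * F b).
Proof.
move=> sU [_ nle]; apply: contrapT => nex; apply: nle.
pose c (a : nat -> bool) := (fun u => F a * u) @` U.
have cI : {in [set: nat -> bool] &, injective c}.
  move=> a b _ _ cab; apply: contrapT => ab; apply: nex; exists a, b; split=> //.
  have : c b (F b) by exists 1; [exact: subgroup1 | rewrite mulg1].
  by rewrite -cab => -[u Uu <-]; rewrite mulKg.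
have /card_eqPle[_ /card_le_trans] := inj_card_eq cI; apply.
by apply: subset_card_le => _ [a _ <-]; exists (F a).
Qed.

Section Tree.
Variables (T : Type) (act : T -> seq bool -> Aut).

(** Lists of steps and lists of bits are both written with the latest entry first. *)
Fixpoint path_aut (l : seq T) (s : seq bool) : Aut :=
  if l is t :: l' then
    if s is b :: s' then path_aut l' s' * (if b then act t s' else 1) else 1
  else 1.

Fixpoint branch (a : nat -> bool) (n : nat) : seq bool :=
  if n is n'.+1 then a n' :: branch a n' else [::].

Lemma size_branch a n : size (branch a n) = n.
Proof. by elim: n => //= n ->. Qed.

Lemma finite_bits n : finite_set [set s : seq bool | size s = n].
Proof.
apply: sub_finite_set (finite_image (@tval n bool) (@finite_finset _ setT)).
by move=> s /eqP sz; exists (Tuple sz).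
Qed.

(** Along each branch of the tree the products of the chosen steps converge, because a
step fixes the points used before it and their preimages under all the products of its
level. *)
Lemma tree_limit (Good : seq T -> Prop) (fixed : seq T -> set H) :
  countable [set: H] -> Good [::] ->
  (forall l, Good l -> finite_set (fixed l)) ->
  (forall l D, finite_set D -> Good l -> exists t,
     Good (t :: l) /\ forall s, size s = size l -> pointwise_stabilizer D (act t s)) ->
  exists L : nat -> seq T,
    [/\ forall n, Good (L n), forall n, exists t, L n.+1 = t :: L n,
        forall n, size (L n) = n &
        forall a, exists f : Aut,
          (forall n, agree (fixed (L n)) f (path_aut (L n) (branch a n))) /\
          (forall x, exists N, forall n, (N <= n)%N ->
             f x = path_aut (L n) (branch a n) x)].
Proof.
move=> /countable_onto[e eP] Good0 fin ext.
have [t0 _] := ext [::] set0 (finite_set0 _) Good0.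
have /choice[F FP] : forall ld : seq T * set H, exists t,
    finite_set ld.2 -> Good ld.1 -> Good (t :: ld.1) /\
      forall s, size s = size ld.1 -> pointwise_stabilizer ld.2 (act t s).
  move=> [l D] /=; have [fD|] := pselect (finite_set D); last by exists t0.
  have [Gl|] := pselect (Good l); last by exists t0.
  by have [t tP] := ext l D fD Gl; exists t.
pose E (l : seq T) (D : set H) n := D `|` fixed l `|` [set e n] `|`
  [set (path_aut l s)^-1 (e n) | s in [set s | size s = n]].
pose st := fix st n : seq T * set H :=
  if n is n'.+1 then
    let D' := E (st n').1 (st n').2 n' in (F ((st n').1, D') :: (st n').1, D')
  else ([::], set0).
pose L n := (st n).1; pose D n := (st n.+1).2.
have DE n : D n = E (L n) (st n).2 n by [].
have stP n : Good (L n) /\ finite_set (st n).2.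
  elim: n => [|n [GL fD]]; first by split=> //; apply: finite_set0.
  have fE : finite_set (D n).
    rewrite DE /E !finite_setU; split; last exact: finite_image (finite_bits n).
    by split; [split=> //; apply: fin | apply: finite_set1].
  by split=> //; have [] := FP (L n, D n) fE GL.
have LS n : L n.+1 = F (L n, D n) :: L n by [].
have sL n : size (L n) = n by elim: n => // n IH; rewrite LS /= IH.
exists L; split=> // [n|n|a]; first by case: (stP n).
  by exists (F (L n, D n)).
pose g n := path_aut (L n) (branch a n).
have gS n : agree (D n) (g n.+1) (g n).
  move=> x Dx; rewrite /g LS [path_aut _ _]/= aut_mulE; congr (_ _).
  case: (a n) => //; have [GL _] := stP n.
  have [_ /(_ (branch a n))] := FP (L n, D n) (proj2 (stP n.+1)) GL.
  by rewrite /= size_branch sL; apply.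
have De n : D n (e n) by rewrite DE; left; right.
have Dcover x : exists n, D n x by have [n <-] := eP x; exists n.
have Donto y : exists n x, D n x /\ g n x = y.
  have [n en] := eP y; exists n, ((g n)^-1 y); rewrite aut_mulKE; split=> //.
  by rewrite DE; right; exists (branch a n); rewrite /= ?size_branch // en.
have Dinc n : D n `<=` D n.+1 by move=> x Dx; rewrite [D n.+1]DE; left; left; left.
have [f fg] := aut_limit Dinc gS Dcover Donto.
exists f; split=> [n x fx|x]; first by apply: fg; rewrite DE; left; left; right.
have [N DN] := Dcover x; exists N => n Nn; apply: fg.
by move: Nn => /subnK<-; elim: (n - N)%N => // k IH; rewrite addSn; apply: Dinc.
Qed.

End Tree.
End Topology.

(** * Open dense conditions and subgroups of small index *)

Section Category.
Variable H : groupType.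
Notation Aut := (automorphism H).
Implicit Types (f g h : Aut) (D K B : set H).

(** The topology is that of pointwise convergence on the discrete set H. *)
Definition open_dense (O : set Aut) :=
  (forall g, O g -> exists2 K, finite_set K & forall g', agree K g' g -> O g') /\
  (forall g D, finite_set D -> exists2 g', agree D g' g & O g').

Lemma open_denseT : open_dense setT.
Proof. by split=> [g _|g D _]; [exists set0 | exists g]. Qed.

Lemma open_dense_translate g (O : set Aut) :
  open_dense O -> open_dense [set h | O (g * h)].
Proof.
move=> [opO deO]; split=> [h /opO[K fK KO]|h D fD].
  by exists K => // h' hh'; apply: KO => x Kx; rewrite !aut_mulE hh'.
have [k kD Ok] := deO (g * h) D fD.
exists (g^-1 * k); first by move=> x Dx; rewrite aut_mulE kD // aut_mulVKE.
by rewrite /= mulVKg.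
Qed.

(** One small step c meets finitely many open dense conditions at once, and does so
robustly: arbitrary perturbations by automorphisms fixing K remain harmless. *)
Lemma robust_choice (J : eqType) (s : seq J) (g1 g2 : J -> Aut) (O : J -> set Aut) D :
  (forall j, open_dense (O j)) -> finite_set D ->
  exists (c : Aut) (K : set H),
    [/\ pointwise_stabilizer D c, finite_set K &
      forall j, j \in s -> forall v w,
        pointwise_stabilizer K v -> pointwise_stabilizer K w ->
        O j ((g1 j * v)^-1 * (g2 j * c * w))].
Proof.
move=> OO fD; elim: s => [|j s [c [K [cD fK IH]]]].
  by exists 1, set0; split=> //; exact: finite_set0.
have [opO deO] := OO j.
have fDK : finite_set (D `|` K) by rewrite finite_setU.
have [g' gE Og'] := deO ((g1 j)^-1 * g2 j * c) (D `|` K) fDK.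
have [K1 fK1 K1O] := opO g' Og'.
pose d := c^-1 * ((g2 j)^-1 * g1 j * g').
have dE : c * d = (g2 j)^-1 * g1 j * g' by rewrite mulVKg.
have dDK : pointwise_stabilizer (D `|` K) d.
  apply: agree_stab => x DKx; rewrite !aut_mulE gE //.
  by rewrite !aut_mulE aut_mulKE aut_mulVKE.
exists (c * d), (K `|` (K1 `|` g' @` K1)); split.
- by apply: stabM => //; apply: stab_sub dDK; left.
- by rewrite !finite_setU; split=> //; split=> //; apply: finite_image.
move=> i; rewrite inE => /predU1P[->|/IH{}IH] v w vK wK.
  apply: K1O => x K1x.
  have -> : (g1 j * v)^-1 * (g2 j * (c * d) * w) = v^-1 * g' * w.
    by rewrite dE invgM !mulgA mulgK mulgVK.
  rewrite !aut_mulE wK; last by right; left.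
  by rewrite (stabV vK) //; right; right; exists x.
have -> : g2 i * (c * d) * w = g2 i * c * (d * w) by rewrite !mulgA.
apply: IH; first by apply: stab_sub vK; left.
apply: stabM; last by apply: stab_sub wK; left.
by apply: stab_sub dDK; right.
Qed.

Lemma injective_unbounded (f : nat -> nat) m : injective f -> exists j, (m <= f j)%N.
Proof.
move=> fI; apply: contrapT => nex.
have sub : {subset map f (iota 0 m.+1) <= iota 0 m}.
  move=> _ /mapP[j _ ->]; rewrite mem_iota add0n ltnNge /=.
  by apply/negP=> le; apply: nex; exists j.
have := uniq_leq_size _ sub; rewrite map_inj_uniq ?iota_uniq // => /(_ isT).
by rewrite size_map !size_iota ltnn.
Qed.

(** Every bit is repeated infinitely often, once as it is and once negated, so that a
single difference between two sequences is seen infinitely often and in both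
directions. *)
Definition spread (a : nat -> bool) (k : nat) : bool :=
  if @unpickle (nat * bool * nat)%type k is Some (i, b, j) then a i (+) b else false.

Lemma spread_often a b m : a <> b -> exists k, [/\ (m <= k)%N, ~~ spread a k & spread b k].
Proof.
move=> ab; have [i abi] : exists i, a i <> b i.
  by apply: contrapT => nex; apply/ab/funext=> i; apply: contrapT => abi; apply: nex; exists i.
have [|j mj] := @injective_unbounded (fun j => pickle (i, a i, j)) m.
  by move=> j j' /(pcan_inj (@pickleK _))[].
exists (pickle (i, a i, j)); rewrite /spread pickleK addbb; split=> //.
by move: abi; case: (a i); case: (b i).
Qed.

Section SmallIndexMeetsGeneric.
Variables (U : set Aut) (sU : is_subgroup U) (ixU : index_lt_continuum U).
Hypothesis countH : countable [set: H].

(** A subgroup of small index is not meagre. Steps c_k are chosen so that, for all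
partial products g1 and g2 of earlier steps, g1^-1 g2 c_k meets the conditions with
numbers up to k robustly. Continuum many subsequences have convergent products; two of
these products lie in the same coset of U, and their quotient meets every condition,
because infinitely often a step occurs in the second but not in the first. *)
Lemma small_index_generic (I : countType) (O : I -> set Aut) B :
  (forall i, open_dense (O i)) -> finite_set B ->
  exists u, [/\ U u, pointwise_stabilizer B u & forall i, O i u].
Proof.
move=> OO fB.
pose O' m := if @unpickle I m is Some i then O i else setT.
have OO' m : open_dense (O' m).
  by rewrite /O'; case: unpickle => // *; apply: open_denseT.
pose act (t : Aut * set H) (s : seq bool) := t.1.
pose path := path_aut act.
pose fixed (l : seq (Aut * set H)) := if l is t :: _ then t.2 else set0.
pose Good := fix Good (l : seq (Aut * set H)) : Prop :=
  if l is t :: l' then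
    [/\ Good l', finite_set t.2, pointwise_stabilizer B t.1 &
       forall s1 s2 m, size s1 = size l' -> size s2 = size l' -> (m <= size l')%N ->
       forall v w, pointwise_stabilizer t.2 v -> pointwise_stabilizer t.2 w ->
         O' m ((path l' s1 * v)^-1 * (path l' s2 * t.1 * w))]
  else True.
have fixed_fin l : Good l -> finite_set (fixed l).
  by case: l => [_|t l []//]; apply: finite_set0.
have step l D : finite_set D -> Good l -> exists t, Good (t :: l) /\
    forall s, size s = size l -> pointwise_stabilizer D (act t s).
  move=> fD Gl; pose J : finType := ((size l).-tuple bool * (size l).-tuple bool * 'I_(size l).+1)%type.
  have fDB : finite_set (D `|` B) by rewrite finite_setU.
  have [c [K [cDB fK cK]]] := robust_choice (enum J)
    (fun j : J => path l (tval j.1.1)) (fun j : J => path l (tval j.1.2))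
    (fun j : J => OO' j.2) fDB.
  exists (c, K); split; last by move=> s _; apply: stab_sub cDB; left.
  split=> //; first by apply: stab_sub cDB; right.
  move=> s1 s2 m /eqP z1 /eqP z2; rewrite -ltnS => lm v w vK wK.
  exact: (cK (Tuple z1, Tuple z2, Ordinal lm) (mem_enum _ _)).
have [L [GL LS sL Lf]] := tree_limit countH (Logic.I : Good [::]) fixed_fin step.
have /choice[F FP] := Lf.
have pathB n s : pointwise_stabilizer B (path (L n) s).
  elim: n s => [|n IH] s; first by have := sL 0%N; case: (L 0%N) => //; case: s.
  have [t LSn] := LS n; have := GL n.+1; rewrite LSn => -[_ _ tB _].
  case: s => [|b s]; first by [].
  by rewrite /path /=; apply: stabM; [apply: IH | case: b].
have FB a : pointwise_stabilizer B (F a).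
  by move=> x Bx; have [_ /(_ x)[N /(_ N (leqnn _))->]] := FP a; apply: pathB.
have [a [b [ab Uab]]] := index_collision (fun a => F (spread a)) sU ixU.
exists ((F (spread a))^-1 * F (spread b)); split=> // [|i].
  by apply: stabM => //; apply: stabV.
have [k [mk ak bk]] := spread_often (pickle i) ab.
have [t LSk] := LS k; have := GL k.+1; rewrite LSk => -[_ ft tB tP].
have tail c : exists2 v, pointwise_stabilizer t.2 v &
    F c = path (L k) (branch c k) * (if c k then t.1 else 1) * v.
  have [/(_ k.+1) + _] := FP c; rewrite LSk /fixed => Fc.
  exists ((path (L k.+1) (branch c k.+1))^-1 * F c).
    by apply: agree_stab; rewrite LSk => x Kx; rewrite Fc.
  by rewrite LSk mulVKg.
have [v vK ->] := tail (spread a); have [w wK ->] := tail (spread b).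
rewrite (negbTE ak) bk mulg1.
have -> : O i = O' (pickle i) by rewrite /O' pickleK.
by apply: tP => //; rewrite ?size_branch ?sL.
Qed.

(** If g fixes B pointwise and lies outside U, and u in U is such that u and g u both
meet the conditions, then g u lies outside U. *)
Lemma outside_generic (I : countType) (O : I -> set Aut) B :
  (forall i, open_dense (O i)) -> finite_set B ->
  ~ (pointwise_stabilizer B `<=` U) ->
  exists v, [/\ ~ U v, pointwise_stabilizer B v & forall i, O i v].
Proof.
move=> OO fB /existsNP[g /not_implyP[gB nUg]].
pose O2 (ib : I * bool) := if ib.2 then O ib.1 else [set h | O ib.1 (g * h)].
have OO2 ib : open_dense (O2 ib).
  by rewrite /O2; case: ib.2; [|apply: open_dense_translate].
have [u [Uu uB uO]] := small_index_generic OO2 fB.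
exists (g * u); split=> [Ugu||i]; last exact: (uO (i, false)).
  by apply: nUg; rewrite -[g](mulgK u); apply: subgroupF.
exact: stabM.
Qed.

End SmallIndexMeetsGeneric.
End Category.

(** * Generic tuples *)

Section Generic.
Variables (H : groupType) (hallH : hall_universal H).
Notation Aut := (automorphism H).
Implicit Types (xs : seq Aut) (F G Z : set H).

Fact inner_subproof (r : H) : `[< is_aut (fun x : H => x ^ r) >].
Proof.
apply/asboolP; split=> [x y|]; first exact: conjMg.
by exists (fun x => x ^ r^-1) => x; [exact: conjgK | exact: conjgKV].
Qed.
Definition inner r : Aut := Automorphism (inner_subproof r).

Lemma innerE r x : inner r x = x ^ r.
Proof. by []. Qed.

Lemma aut_local_conj G (x : Aut) : is_subgroup G -> finite_set G ->
  exists r, forall g, G g -> x g = g ^ r.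
Proof.
move=> sG fG; apply: (hall_conj hallH (f := id)) => //; split=> g g' _ _ //.
  exact: autM.
exact: aut_inj.
Qed.

Lemma generated_finite F : finite_set F -> finite_set (generated_subgroup F).
Proof. exact: hall_locally_finite. Qed.

Lemma conj_subgroup G r : is_subgroup G -> is_subgroup ((fun g => g ^ r) @` G).
Proof.
move=> sG; apply: (image_is_subgroup sG).
by apply: (@embedding_conj _ _ _ id).
Qed.

(** These are the two properties that make H with the automorphisms xs a homogeneous
limit of the finite groups with as many automorphisms. The finite extensions of G are
represented by subsets of H on which the automorphisms act as conjugations, which loses
nothing because every finite extension embeds in H over G. *)
Definition generic xs :=
  (forall F, finite_set F -> exists G, [/\ is_subgroup G, finite_set G, F `<=` G &
     forall x, x \in xs -> forall g, G g -> G (x g)]) /\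
  (forall G Z (xq : seq (Aut * H)), is_subgroup G -> finite_set G -> finite_set Z ->
     unzip1 xq = xs ->
     (forall p, p \in xq -> forall g, G g -> p.1 g = g ^ p.2 /\ G (p.1 g)) ->
     exists h, (forall g, G g -> g ^ h = g) /\
       forall p, p \in xq -> forall z, Z z -> p.1 (z ^ h) = (z ^ p.2) ^ h).

Lemma generic_nil : generic [::].
Proof.
split=> [F fF|G Z xq _ _ _]; last first.
  by case: xq => // _ _; exists 1; split=> // g _; rewrite conjg1.
exists (generated_subgroup F); split=> //; first exact: generated_is_subgroup.
  exact: generated_finite.
exact: sub_generated.
Qed.

Section BackAndForth.

Definition matched (xy : seq (Aut * Aut)) (G : set H) (r : H) :=
  [/\ is_subgroup G, finite_set G &
     forall p, p \in xy -> forall g, G g -> G (p.1 g) /\ (p.1 g) ^ r = p.2 (g ^ r)].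

Definition swap (xy : seq (Aut * Aut)) := [seq (p.2, p.1) | p <- xy].

Lemma swapK xy : swap (swap xy) = xy.
Proof. by rewrite /swap -map_comp map_id_in // => -[]. Qed.

Lemma matched_swap xy G r : matched xy G r ->
  matched (swap xy) ((fun g => g ^ r) @` G) r^-1.
Proof.
move=> [sG fG xyG]; split; [exact: conj_subgroup | exact: finite_image |].
move=> _ /mapP[p pxy ->] _ [g Gg <-] /=; have [Gpg <-] := xyG p pxy g Gg.
by rewrite !conjgK; split=> //; exists (p.1 g).
Qed.

(** The finite invariant group G1 around G and F, conjugated by r, is an extension of
the conjugate of G, and genericity of the second tuple realizes it. *)
Lemma matched_extend xy G r F : matched xy G r ->
  generic (unzip1 xy) -> generic (unzip2 xy) -> finite_set F ->
  exists G' r', [/\ matched xy G' r', G `<=` G', F `<=` G' &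
    forall g, G g -> g ^ r' = g ^ r].
Proof.
move=> [sG fG xyG] [inv1 _] [_ ext2] fF.
have [|G1 [sG1 fG1 FG1 xG1]] := inv1 (G `|` F); first by rewrite finite_setU.
have /choice[q qP] := fun x => aut_local_conj x sG1 fG1.
pose xq := [seq (p.2, q p.1 ^ r) | p <- xy].
have [||||h [hG hZ]] := ext2 _ ((fun g => g ^ r) @` G1) xq (conj_subgroup r sG).
- exact: finite_image.
- exact: finite_image.
- by rewrite /xq /unzip1 -map_comp.
- move=> _ /mapP[p pxy ->] _ [g Gg <-] /=; have [Gpg <-] := xyG p pxy g Gg.
  by rewrite -conjJg -qP; [split=> //; exists (p.1 g) | apply: FG1; left].
exists G1, (r * h); split.
- split=> // p pxy g G1g; split; first by apply: xG1 => //; apply: map_f.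
  have /= E := hZ _ (map_f (fun p => (p.2, q p.1 ^ r)) pxy) _ (imageP _ G1g).
  by rewrite !conjgM E -conjJg -qP.
- by move=> g Gg; apply: FG1; left.
- by move=> g Fg; apply: FG1; right.
- by move=> g Gg; rewrite conjgM hG //; exists g.
Qed.

Lemma matched_step xy G r e : matched xy G r ->
  generic (unzip1 xy) -> generic (unzip2 xy) ->
  exists G' r', [/\ matched xy G' r', G `<=` G', G' e,
    exists2 x, G' x & x ^ r' = e & forall g, G g -> g ^ r' = g ^ r].
Proof.
move=> mG g1 g2; have fe := finite_set1 e.
have [G1 [r1 [m1 GG1 eG1 r1E]]] := matched_extend mG g1 g2 fe.
have s12 : unzip1 (swap xy) = unzip2 xy by rewrite /unzip1 /swap -map_comp.
have s21 : unzip2 (swap xy) = unzip1 xy by rewrite /unzip2 /swap -map_comp.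
have := matched_extend (matched_swap m1); rewrite s12 s21.
move=> /(_ _ g2 g1 fe)[G2 [r2 [m2 GG2 eG2 r2E]]].
exists ((fun g => g ^ r2) @` G2), r2^-1.
have sub g : G1 g -> exists2 x, G2 x & g = x ^ r2.
  move=> G1g; exists (g ^ r1); first by apply: GG2; exists g.
  by rewrite r2E ?conjgK //; exists g.
split.
- by rewrite -[xy]swapK; apply: matched_swap.
- by move=> g /GG1/sub[x G2x ->]; exists x.
- by have [x G2x ->] := sub e (eG1 _ erefl); exists x.
- by exists (e ^ r2); [exists e => //; apply: eG2 | rewrite conjgK].
- move=> g Gg; have G1g := GG1 _ Gg.
  by rewrite -(r1E _ Gg) -[X in X ^ r2^-1](conjgK r1) -r2E ?conjgK //; exists g.
Qed.

(** Back and forth: all finite stages are conjugations by elements of H, and the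
conjugating automorphism is their limit. *)
Lemma generic_conjugate xy G :
  generic (unzip1 xy) -> generic (unzip2 xy) -> is_subgroup G -> finite_set G ->
  (forall p, p \in xy -> forall g, G g -> p.1 g = p.2 g /\ G (p.1 g)) ->
  exists2 c : Aut, pointwise_stabilizer G c &
    forall p, p \in xy -> c * p.1 = p.2 * c.
Proof.
move=> g1 g2 sG fG xyG; have [e eP] := countable_onto (hall_countable hallH).
have /choice[N NP] : forall Grn : set H * H * nat, exists Gr : set H * H,
    matched xy Grn.1.1 Grn.1.2 -> [/\ matched xy Gr.1 Gr.2, Grn.1.1 `<=` Gr.1,
      Gr.1 (e Grn.2), exists2 x, Gr.1 x & x ^ Gr.2 = e Grn.2 &
      forall g, Grn.1.1 g -> g ^ Gr.2 = g ^ Grn.1.2].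
  move=> [[G' r] n] /=; have [m|] := pselect (matched xy G' r); last by exists (G', r).
  by have [G1 [r1 P]] := matched_step (e n) m g1 g2; exists (G1, r1).
pose st := fix st n : set H * H := if n is n'.+1 then N (st n', n') else (G, 1).
have stM n : matched xy (st n).1 (st n).2.
  elim: n => [|n IH]; last by have [] := NP (st n, n) IH.
  by split=> // p pxy g Gg; have [E Gpg] := xyG p pxy g Gg; rewrite !conjg1.
have stS n := NP (st n, n) (stM n).
have [c cP] : exists c : Aut, forall n, agree (st n).1 c (inner (st n).2).
  apply: aut_limit => [n|n g|x|y].
  - by have [] := stS n.
  - by have [_ _ _ _ E] := stS n; apply: E.
  - by have [n <-] := eP x; exists n.+1; have [] := stS n.
  - have [n <-] := eP y; have [_ _ _ [x Gx xr] _] := stS n.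
    by exists n.+1, x.
exists c => [g Gg|p pxy]; first by rewrite (cP 0%N) // innerE conjg1.
apply: aut_ext => z; rewrite !aut_mulE.
have [n Gz] : exists n, (st n).1 z.
  by have [n <-] := eP z; exists n.+1; have [] := stS n.
have [_ _ /(_ p pxy z Gz)[Gpz E]] := stM n.
by rewrite !(cP n) // !innerE.
Qed.

End BackAndForth.

End Generic.

(** * Genericity as a countable family of open dense conditions *)

Section GenericIsComeager.
Variables (H : groupType) (hallH : hall_universal H).
Notation Aut := (automorphism H).
Implicit Types (xs : seq Aut) (F G Z : set H).

Let genF := generated_finite hallH.

(** The two requirements of genericity, as conditions on an entry y added to a
tuple. *)
Definition invariant_over xs F : set Aut := [set y |
  exists G, [/\ is_subgroup G, finite_set G, F `<=` G &
    forall x, x \in y :: xs -> forall g, G g -> G (x g)]].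

Definition realized_over (xq : seq (Aut * H)) (q : H) G Z : set Aut := [set y |
  (forall p, p \in (y, q) :: xq -> forall g, G g -> p.1 g = g ^ p.2 /\ G (p.1 g)) ->
  exists h, (forall g, G g -> g ^ h = g) /\
    forall p, p \in (y, q) :: xq -> forall z, Z z -> p.1 (z ^ h) = (z ^ p.2) ^ h].

(** Given y and a finite set D, all automorphisms involved are conjugations by
elements r and P x on a finite subgroup G that contains D and its image under y. The
group generated by G and these elements is realized over G compatibly with xs, and
the inner automorphism given by the realized copy of r can replace y. *)
Lemma invariant_open_dense xs F : generic xs -> finite_set F ->
  open_dense (invariant_over xs F).
Proof.
move=> [inv ext] fF; split=> [y [G [sG fG FG xG]]|y D fD].
  exists G => // y' yy'; exists G; split=> // x; rewrite inE => /predU1P[->|xxs] g Gg.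
    by rewrite yy' //; apply: xG => //; apply: mem_head.
  by apply: xG => //; rewrite inE xxs orbT.
have [|G [sG fG DFG xG]] := inv (D `|` (y @` D) `|` F).
  by rewrite !finite_setU; split=> //; split=> //; apply: finite_image.
have /choice[P PP] := fun x => aut_local_conj hallH x sG fG.
have [r yr] := aut_local_conj hallH y sG fG.
pose S := generated_subgroup (G `|` [set r] `|` [set` map P xs]).
have sS : is_subgroup S by apply: generated_is_subgroup.
have fS : finite_set S.
  apply: genF; rewrite !finite_setU; split; last exact: finite_seq.
  by split=> //; apply: finite_set1.
have GS g : G g -> S g by move=> Gg; apply: sub_generated; left; left.
have Sr : S r by apply: sub_generated; left; right.
have SP x : x \in xs -> S (P x).
  by move=> xxs; apply: sub_generated; right; apply: map_f.
have [||h [hG hS]] := ext G S [seq (x, P x) | x <- xs] sG fG fS.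
- by rewrite /unzip1 -map_comp map_id.
- by move=> _ /mapP[x xxs ->] g Gg /=; rewrite PP //; split=> //; rewrite -PP //; apply: xG.
exists (inner (r ^ h)).
  move=> d Dd; have Gd : G d by apply: DFG; left; left.
  have Gyd : G (y d) by apply: DFG; left; right; exists d.
  by rewrite innerE -[X in X ^ _](hG d Gd) -conjJg -yr // hG.
exists ((fun g => g ^ h) @` S); split.
- exact: conj_subgroup.
- exact: finite_image.
- by move=> f Ff; have Gf : G f by [apply: DFG; right]; exists f; [exact: GS | exact: hG].
- move=> x; rewrite inE => /predU1P[->|xxs] _ [z Sz <-].
    by rewrite innerE -conjJg; exists (z ^ r) => //; apply: (subgroupJ sS).
  have /= -> := hS _ (map_f (fun x => (x, P x)) xxs) z Sz.
  by exists (z ^ P x) => //; apply: (subgroupJ sS) => //; apply: SP.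
Qed.

(** First y is changed so that D and G lie in a finite invariant subgroup G1. The
extension demanded over G and the subgroup G1 are amalgamated together with the
actions on them, the amalgam is realized over G1 compatibly with xs, and y is replaced
by the inner automorphism that acts on the amalgam as demanded. *)
Lemma realized_open_dense xs xq q G Z :
  generic xs -> unzip1 xq = xs -> is_subgroup G -> finite_set G -> finite_set Z ->
  open_dense (realized_over xq q G Z).
Proof.
move=> gxs xqE sG fG fZ; split=> [y yO|y D fD].
  have [hyp|nhyp] := pselect (forall p, p \in (y, q) :: xq ->
      forall g, G g -> p.1 g = g ^ p.2 /\ G (p.1 g)); last first.
    exists G => // y' yy' hyp; exfalso; apply: nhyp => p.
    rewrite inE => /predU1P[->|pxq] g Gg /=.
      by have := hyp _ (mem_head _ _) g Gg; rewrite /= yy'.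
    by apply: hyp => //; rewrite inE pxq orbT.
  have [h [hG hZ]] := yO hyp.
  exists ((fun z => z ^ h) @` Z); first exact: finite_image.
  move=> y' yy' _; exists h; split=> // p; rewrite inE => /predU1P[->|pxq] z Zz.
    rewrite yy'; last by exists z.
    exact: (hZ _ (mem_head _ _) z Zz).
  by apply: hZ => //; rewrite inE pxq orbT.
have fDG : finite_set (D `|` G) by rewrite finite_setU.
have [_ /(_ y (D `|` G) fDG)[y1 y1D [G1 [sG1 fG1 DG1 xG1]]]] :=
  invariant_open_dense gxs fDG.
have y1y : agree D y1 y by move=> d Dd; apply: y1D; left.
have [hyp|nhyp] := pselect (forall p, p \in (y1, q) :: xq ->
  forall g, G g -> p.1 g = g ^ p.2 /\ G (p.1 g)); last by exists y1.
have /choice[P PP] := fun x => aut_local_conj hallH x sG1 fG1.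
pose xyq := (y1, q) :: xq.
pose PG := generated_subgroup (G1 `|` [set` [seq P p.1 | p <- xyq]]).
pose S := generated_subgroup (Z `|` G `|` [set` [seq p.2 | p <- xyq]]).
have sPG : is_subgroup PG by apply: generated_is_subgroup.
have sS : is_subgroup S by apply: generated_is_subgroup.
have fPG : finite_set PG.
  by apply: genF; rewrite !finite_setU; split=> //; apply: finite_seq.
have fS : finite_set S.
  by apply: genF; rewrite !finite_setU; split=> //; apply: finite_seq.
have G1PG g : G1 g -> PG g by move=> Gg; apply: sub_generated; left.
have GG1 g : G g -> G1 g by move=> Gg; apply: DG1; right.
have GS g : G g -> S g by move=> Gg; apply: sub_generated; left; right.
have ZS z : Z z -> S z by move=> Zz; apply: sub_generated; left; left.
have GPG g : G g -> PG g by move=> /GG1/G1PG.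
have [t [E [tG tE]]] := hall_amalgamation hallH sPG fPG sS fS sG GPG GS.
have pE p : p \in xyq -> (forall g, PG g -> g ^ E (P p.1) p.2 = g ^ P p.1) /\
    (forall z, S z -> (z ^ t) ^ E (P p.1) p.2 = (z ^ p.2) ^ t).
  move=> pxyq; apply: tE.
  - by apply: sub_generated; right; apply: (map_f (fun p => P p.1)).
  - by apply: sub_generated; right; apply: map_f.
  move=> g Gg; have [e Gp] := hyp p pxyq g Gg.
  by rewrite -PP ?e //; [rewrite -e | apply: GG1].
have [_ ext] := gxs.
have [|||h [hG hS]] := ext G1 ((fun z => z ^ t) @` S)
    [seq (p.1, E (P p.1) p.2) | p <- xq] sG1 fG1.
- exact: finite_image.
- by rewrite /unzip1 -map_comp -xqE.
- move=> _ /mapP[p pxq ->] g Gg /=.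
  have pxyq : p \in xyq by rewrite inE pxq orbT.
  have [pE1 _] := pE p pxyq.
  rewrite pE1; last exact: G1PG.
  rewrite -PP //; split=> //; apply: xG1 => //; rewrite inE -xqE.
  by apply/orP; right; apply: map_f.
have [eG1 eS] := pE _ (mem_head _ _).
exists (inner (E (P y1) q ^ h)).
  move=> d Dd; have G1d : G1 d by apply: DG1; left.
  have G1y : G1 (y1 d) by apply: xG1 => //; apply: mem_head.
  rewrite -y1y // innerE -[X in X ^ _](hG d G1d) -conjJg eG1; last exact: G1PG.
  by rewrite -PP // hG.
move=> _; exists (t * h); split.
  by move=> g Gg; rewrite conjgM tG // hG //; apply: GG1.
move=> p; rewrite inE => /predU1P[->|pxq] z Zz; rewrite !conjgM.
  by rewrite innerE -conjJg eS //; apply: ZS.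
have /= -> := hS _ (map_f (fun p => (p.1, E (P p.1) p.2)) pxq) _ (imageP _ (ZS z Zz)).
have pxyq : p \in xyq by rewrite inE pxq orbT.
by have [_ ->] := pE p pxyq; last exact: ZS.
Qed.

(** The boolean selects one of the two requirements; the lists encode finite sets and
conjugating elements through an enumeration of H. *)
Definition demand : countType := (bool * (seq nat * seq nat * seq nat))%type.

(** Countably many conditions suffice because H is countable, so that it has only
countably many finite subsets. *)
Lemma generic_extension xs : generic xs ->
  exists O : demand -> set Aut, (forall i, open_dense (O i)) /\
    forall y, (forall i, O i y) -> generic (y :: xs).
Proof.
move=> gxs; have [e eP] := countable_onto (hall_countable hallH).
have [k ke] : exists k : H -> nat, forall x, e (k x) = x.
  by have /choice[k kP] := eP; exists k.
pose fs (s : seq nat) : set H := [set` map e s].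
have fsP A : finite_set A -> exists s, fs s = A.
  move=> /finite_seqP[s ->]; exists (map k s); rewrite /fs -map_comp.
  by rewrite (eq_map (g := id)) ?map_id // => x; rewrite /= ke.
pose O (i : demand) : set Aut :=
  let: (b, (s1, s2, s3)) := i in
  if b then invariant_over xs (fs s1) else
  if `[< is_subgroup (fs s1) >] && (size s3 == (size xs).+1) then
    realized_over (zip xs (map e (behead s3))) (e (head 0%N s3)) (fs s1) (fs s2)
  else setT.
exists O; split=> [[b [[s1 s2] s3]]|y yO].
  rewrite /O; case: b; first exact: invariant_open_dense (finite_seq _).
  case: ifP => [/andP[/asboolP ss /eqP sz]|_]; last exact: open_denseT.
  apply: (realized_open_dense (xs := xs)) => //; do ?exact: finite_seq.
  by rewrite unzip1_zip // size_map size_behead sz.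
split=> [F fF|G Z xq sG fG fZ xqE xqG].
  by have [s <-] := fsP F fF; apply: (yO (true, (s, [::], [::]))).
case: xq xqE xqG => // -[y1 q] xq /= [-> xqE] xqG.
have [s1 s1E] := fsP G fG; have [s2 s2E] := fsP Z fZ.
have := yO (false, (s1, s2, map k (q :: unzip2 xq))).
rewrite /O s1E s2E -xqE /= !size_map eqxx andbT.
have -> : `[< is_subgroup G >] by apply/asboolP.
rewrite ke -map_comp (eq_map (g := id)) ?map_id => [|x]; last by rewrite /= ke.
by rewrite zip_unzip; apply.
Qed.

End GenericIsComeager.

(** * Subgroups of small index are open *)

Section SmallIndex.
Variables (H : groupType) (hallH : hall_universal H).
Notation Aut := (automorphism H).
Variables (U : set Aut) (sU : is_subgroup U) (ixU : index_lt_continuum U).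

Section Tree.
Notation T := (Aut * Aut * (seq bool -> Aut))%type.

(** A step is a triple (u, v, c); a sequence of bits selects u or v in every step. *)
Fixpoint selection (l : seq T) (s : seq bool) : seq Aut :=
  if l is t :: l' then
    if s is b :: s' then (if b then t.1.2 else t.1.1) :: selection l' s' else [::]
  else [::].

(** With u in U and v outside U, the conjugator c s makes v and u indistinguishable
while preserving all the conjugations by which the earlier selected automorphisms
were related. *)
Fixpoint separating (l : seq T) : Prop :=
  if l is t :: l' then
    [/\ separating l', U t.1.1, ~ U t.1.2 &
      forall s, size s = size l' ->
        [/\ generic (t.1.1 :: selection l' s), generic (t.1.2 :: selection l' s),
            t.2 s * t.1.2 = t.1.1 * t.2 s &
            forall x, x \in selection l' s -> t.2 s * x = x * t.2 s]]
  else True.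

Lemma separating_generic l s : separating l -> size s = size l -> generic (selection l s).
Proof.
case: l s => [|t l] [|b s] //=; first by move=> _ _; apply: generic_nil.
by move=> [_ _ _ tP] [sz]; have [] := tP s sz; case: b.
Qed.

Hypothesis notopen : forall B, finite_set B -> ~ (pointwise_stabilizer B `<=` U).

(** Small index provides u in U, and non-openness provides v outside U, both generic
over all the selections of the previous level at once and trivial on large finite
subgroups. On these, u and v agree, so generic tuples are conjugate by c s. *)
Lemma separating_extend l D : finite_set D -> separating l -> exists t : T,
  separating (t :: l) /\ forall s, size s = size l -> pointwise_stabilizer D (t.2 s).
Proof.
move=> fD Gl.
have /choice[G GP] : forall s, exists G : set H, size s = size l ->
    [/\ is_subgroup G, finite_set G, D `<=` G &
      forall x, x \in selection l s -> forall g, G g -> G (x g)].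
  move=> s; have [sz|ne] := eqVneq (size s) (size l); last by exists set0 => /eqP; rewrite (negPf ne).
  have [inv _] := separating_generic Gl sz; have [G GP] := inv D fD.
  by exists G.
pose B := \bigcup_(s in [set s : seq bool | size s = size l]) G s.
have fB : finite_set B by apply: bigcup_finite => [|s /GP[]//]; exact: finite_bits.
have /choice[O OP] : forall s, exists O : demand -> set Aut, (forall i, open_dense (O i)) /\
    (size s = size l -> forall y, (forall i, O i y) -> generic (y :: selection l s)).
  move=> s; have [sz|ne] := eqVneq (size s) (size l).
    by have [O [OO Og]] := generic_extension hallH (separating_generic Gl sz); exists O.
  exists (fun=> setT); split=> [_|/eqP]; first exact: open_denseT.
  by rewrite (negPf ne).
pose O2 (si : seq bool * demand) := O si.1 si.2.
have OO2 si : open_dense (O2 si) by apply: (proj1 (OP si.1)).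
have cH := hall_countable hallH.
have [u [Uu uB uO]] := small_index_generic sU ixU cH OO2 fB.
have [v [nUv vB vO]] := outside_generic sU ixU cH OO2 fB (notopen fB).
have gen s y : size s = size l -> (forall si, O2 si y) -> generic (y :: selection l s).
  by move=> sz yO; have [_ Og] := OP s; apply: Og => // i; apply: (yO (s, i)).
have /choice[c cP] : forall s, exists c : Aut, size s = size l ->
    [/\ pointwise_stabilizer D c, c * v = u * c &
      forall x, x \in selection l s -> c * x = x * c].
  move=> s; have [sz|ne] := eqVneq (size s) (size l); last first.
    by exists 1 => /eqP; rewrite (negPf ne).
  pose xy := (v, u) :: [seq (x, x) | x <- selection l s].
  have [sG fG DG xG] := GP s sz.
  have GB g : G s g -> B g by exists s.
  have e1 : unzip1 xy = v :: selection l s by rewrite /= /unzip1 -map_comp map_id.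
  have e2 : unzip2 xy = u :: selection l s by rewrite /= /unzip2 -map_comp map_id.
  have [||p pxy g Gg|d dG dxy] := generic_conjugate hallH (xy := xy) _ _ sG fG.
  - by rewrite e1; apply: gen.
  - by rewrite e2; apply: gen.
  - move: pxy; rewrite inE => /predU1P[->|/mapP[x xs ->]] /=; last by split=> //; apply: xG.
    by rewrite uB ?vB //; apply: GB.
  exists d => _; split=> [||x xs]; first by apply: stab_sub dG.
    exact: (dxy _ (mem_head _ _)).
  by apply: (dxy (x, x)); rewrite inE map_f ?orbT.
exists (u, v, c); split; last by move=> s /cP[].
by split=> // s sz; have [] := cP s sz; split=> //; apply: gen.
Qed.

(** Along the tree, the conjugates of the selected automorphisms stabilize. If two
branches part at a step (u, v, c), the limit F a of the one and the limit F b of the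
other conjugate u and v, respectively, to the same automorphism. The quotient of F a
and F b then conjugates an element of U to one outside U, so it is not in U. Hence U
has continuum many cosets. *)
Lemma small_index_contradiction : False.
Proof.
have cH := hall_countable hallH.
pose act (t : T) := t.2.
have [L [GL LS sL /choice[F FP]]] := tree_limit (act := act) (fixed := fun=> set0) cH
  (I : separating [::]) (fun _ _ => finite_set0 _) separating_extend.
pose g a n := path_aut act (L n) (branch a n).
have gS a n : exists2 t, L n.+1 = t :: L n &
    g a n.+1 = g a n * (if a n then t.2 (branch a n) else 1).
  by have [t LSn] := LS n; exists t; rewrite // /g LSn.
have conjF a n x : x \in selection (L n) (branch a n) ->
    F a * x = (g a n * x * (g a n)^-1) * F a.
  move=> xs; have stable m : (n <= m)%N ->
      x \in selection (L m) (branch a m) /\ g a m * x = (g a n * x * (g a n)^-1) * g a m.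
    move=> /subnK<-; elim: (m - n)%N => [|k [IHx IH]].
      by rewrite add0n; split=> //; rewrite mulgVK.
    rewrite addSn; have [t LSk ->] := gS a (k + n)%N.
    have := GL (k + n).+1; rewrite LSk => -[_ _ _ tP].
    have [|_ _ _ tc] := tP (branch a (k + n)); first by rewrite size_branch sL.
    split; first by rewrite /= inE IHx orbT.
    by case: (a _); rewrite ?mulg1 // -mulgA tc // mulgA IH !mulgA.
  apply: aut_ext => z; have [_ lim] := FP a.
  have [N1 P1] := lim z; have [N2 P2] := lim (x z).
  pose m := maxn n (maxn N1 N2).
  have [_ E] : _ := stable m (leq_maxl _ _).
  have mN1 : (N1 <= m)%N by rewrite !leq_max leqnn orbT.
  have mN2 : (N2 <= m)%N by rewrite !leq_max leqnn !orbT.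
  rewrite [LHS]aut_mulE [RHS]aut_mulE (P1 m mN1) (P2 m mN2) -/(g a m).
  by rewrite -[LHS]aut_mulE E.
have key a b n : (forall i, (i < n)%N -> a i = b i) -> ~~ a n -> b n ->
    ~ U ((F a)^-1 * F b).
  move=> eqab an bn Uab; have brE : branch a n = branch b n.
    elim: n eqab {an bn} => //= n IH eqab.
    by rewrite eqab // IH // => i lt; apply: eqab; rewrite ltnS ltnW.
  have [t LSn gan] := gS a n; have [t' LSn' gbn] := gS b n.
  have E : t' = t by move: LSn'; rewrite LSn => -[].
  subst t'; have gE : g a n = g b n by rewrite /g brE.
  have := GL n.+1; rewrite LSn => -[_ Uu nUv tP].
  have [|_ _ tc _] := tP (branch b n); first by rewrite size_branch sL.
  have Fu : F a * t.1.1 = (g a n.+1 * t.1.1 * (g a n.+1)^-1) * F a.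
    by apply: conjF; rewrite LSn /= (negPf an) mem_head.
  have Fv : F b * t.1.2 = (g b n.+1 * t.1.2 * (g b n.+1)^-1) * F b.
    by apply: conjF; rewrite LSn /= bn mem_head.
  have wE : g b n.+1 * t.1.2 * (g b n.+1)^-1 = g a n.+1 * t.1.1 * (g a n.+1)^-1.
    by rewrite gan gbn bn (negPf an) mulg1 gE -(mulgA (g b n) _ t.1.2) tc invgM !mulgA mulgK.
  move: Fu Fv; rewrite wE; move: (_ * _^-1) => w Fu Fv.
  have uE : t.1.1 = w ^ F a by rewrite conjgE -Fu mulKg.
  have vE : t.1.2 = w ^ F b by rewrite conjgE -Fv mulKg.
  apply: nUv; have -> : t.1.2 = t.1.1 ^ ((F a)^-1 * F b).
    by rewrite uE vE -conjgM mulVKg.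
  exact: (subgroupJ sU).
have [a [b [ab Uab]]] := index_collision F sU ixU.
have nab : exists n, a n != b n.
  by apply: contrapT => nex; apply/ab/funext=> i; apply/eqP/negPn/negP=> ni; apply: nex; exists i.
case: (ex_minnP nab) => n abn min.
have eqab i : (i < n)%N -> a i = b i.
  by move=> lt; apply/eqP; apply: contraTT lt => /min; rewrite leqNgt.
case: (boolP (a n)) abn => an; case: (boolP (b n)) => bn // _.
  apply: (key b a n) => //; first by move=> i /eqab.
  by rewrite -[(F b)^-1 * _]invgK invgM invgK; apply: subgroupV.
exact: (key a b n).
Qed.
End Tree.

Lemma small_index_open : exists B, finite_set B /\ pointwise_stabilizer B `<=` U.
Proof.
apply: contrapT => nex; apply: small_index_contradiction => B fB BU.
by apply: nex; exists B.
Qed.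

End SmallIndex.

(** * The support of an open subgroup *)

Section Support.
Variables (H : groupType) (hallH : hall_universal H).
Notation Aut := (automorphism H).
Implicit Types A B : set H.
Variables (U : set Aut) (sU : is_subgroup U).

Lemma innerM (r s : H) : inner (r * s) = inner s * inner r.
Proof. by apply: aut_ext => x; rewrite aut_mulE !innerE conjgM. Qed.

Lemma innerV (r : H) : inner r^-1 = (inner r)^-1.
Proof.
by apply: aut_ext => x; apply: (@aut_inj _ (inner r)); rewrite aut_mulKE innerE conjgKV.
Qed.

(** An automorphism fixing the intersection agrees on A with an inner one, whose
conjugating element then centralizes the intersection. *)
Lemma stab_intersection A B :
  is_subgroup A -> finite_set A -> is_subgroup B -> finite_set B ->
  pointwise_stabilizer A `<=` U -> pointwise_stabilizer B `<=` U ->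
  pointwise_stabilizer (A `&` B) `<=` U.
Proof.
move=> sA fA sB fB AU BU f fAB; have [r rP] := aut_local_conj hallH f sA fA.
pose D := [set x : H | U (inner x)].
have sD : is_subgroup D.
  apply: is_subgroupP => [|x y Dx Dy].
    by apply: AU => a _; rewrite innerE conjg1.
  by rewrite /D /= innerM innerV; apply: (subgroupM sU) => //; apply: (subgroupV sU).
have Dr : D r.
  apply: (hall_centralizers_generate hallH sA fA sB fB sD) => [x xA|x xB|c Ac Bc].
  - by apply: AU => a Aa; rewrite innerE xA.
  - by apply: BU => b Bb; rewrite innerE xB.
  - by rewrite -rP // fAB.
rewrite -[f](mulVKg (inner r)); apply: (subgroupM sU) => //; apply: AU.
by apply: agree_stab => a Aa; rewrite innerE rP.
Qed.

Lemma stab_image A u : U u -> pointwise_stabilizer A `<=` U ->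
  pointwise_stabilizer (u @` A) `<=` U.
Proof.
move=> Uu AU g gA; have: U (u^-1 * (g * u)).
  by apply: AU => a Aa; rewrite !aut_mulE gA ?aut_mulVKE //; exists a.
move=> Ug; rewrite -[g](mulgK u) -(mulVKg u (g * u)).
by apply: (subgroupF sU) => //; apply: (subgroupM sU).
Qed.

(** An inner automorphism that fixes A pointwise preserves B, whereas any element of
B outside A can be moved out of the finite set B. *)
Lemma stab_between_sub A B : is_subgroup A -> finite_set A -> finite_set B ->
  pointwise_stabilizer A `<=` U -> U `<=` setwise_stabilizer B -> B `<=` A.
Proof.
move=> sA fA fB AU UB b Bb; apply: contrapT => Ab.
have [t tA] := hall_centralizer_moves hallH sA fA fB Ab; apply.
have /UB BtB : U (inner t) by apply: AU => a Aa; rewrite innerE tA.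
by rewrite -BtB; exists b.
Qed.

Lemma minimal_support B : finite_set B -> is_subgroup B ->
  pointwise_stabilizer B `<=` U ->
  exists A, [/\ is_subgroup A, finite_set A, pointwise_stabilizer A `<=` U &
    forall A', is_subgroup A' -> A' `<=` A -> pointwise_stabilizer A' `<=` U -> A' = A].
Proof.
move=> /finite_seqP[s Bs]; have [n] := ubnP (size s).
have {Bs}: B `<=` [set` s] by rewrite Bs.
elim: n s B => // n IH s B Bs ltn sB BU.
have fB : finite_set B by apply: sub_finite_set Bs (finite_seq s).
have [min|nmin] := pselect (forall A', is_subgroup A' -> A' `<=` B ->
  pointwise_stabilizer A' `<=` U -> A' = B); first by exists B.
move/existsNP: nmin => [A' /not_implyP[sA' /not_implyP[A'B /not_implyP[A'U neq]]]].
have [x [Bx A'x]] : exists x, B x /\ ~ A' x.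
  apply: contrapT => nex; apply: neq; apply/seteqP; split=> // x Bx.
  by apply: contrapT => A'x; apply: nex; exists x.
apply: (IH [seq y <- s | predC1 x y] A') => //.
  move=> y A'y; rewrite /= mem_filter; apply/andP; split; last exact/Bs/A'B.
  by apply/eqP=> yx; apply: A'x; rewrite -yx.
rewrite -ltnS (leq_trans _ ltn) // size_filter ltnS -(count_predC (pred1 x) s).
by rewrite -add1n leq_add2r -has_count has_pred1; apply: Bs.
Qed.

End Support.

Theorem theorem1 (H : groupType) (hallH : hall_universal H)
    (U : set (automorphism H)) (sgU : is_subgroup U) (ixU : index_lt_continuum U) :
  exists! A : set H,
    [/\ is_subgroup A, finite_set A,
        pointwise_stabilizer A `<=` U & U `<=` setwise_stabilizer A].
Proof.
have [B [fB BU]] := small_index_open hallH sgU ixU.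
have [A [sA fA AU Amin]] := minimal_support (generated_finite hallH fB)
  (generated_is_subgroup B) (subset_trans (stab_sub (@sub_generated _ B)) BU).
(* The intersection of A with its image still supports U, so minimality applies. *)
have sub_image u : U u -> A `<=` u @` A.
  move=> Uu; have eu : embedding A u by split=> x y _ _; [exact: autM | exact: aut_inj].
  suff E : A `&` u @` A = A by rewrite -{1}E; apply: subIsetr.
  apply: Amin => //; first exact: subgroupI (image_is_subgroup sA eu).
  apply: (stab_intersection hallH) => //; first exact: image_is_subgroup eu.
    exact: finite_image.
  exact: stab_image.
have UA : U `<=` setwise_stabilizer A.
  move=> u Uu; apply/seteqP; split; last exact: sub_image.
  move=> _ [a Aa <-]; have [b Ab <-] := sub_image _ (subgroupV sgU Uu) a Aa.
  by rewrite aut_mulKE.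
exists A; split=> // A' [sA' fA' A'U UA'].
by apply/seteqP; split; apply: (stab_between_sub hallH (U := U)).
Qed.
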